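(* Under the first-order correlation model, for the typical user in the 2D network the probability density functions of the serving BS distance $X_0$ conditioned on $E_{\mathsf L}$ and on $E_{\mathsf N}$ (each when the corresponding $A_s>0$) are $$f_{X_0|E_{\mathsf L}}(x)=\frac{1}{A_{\mathsf L}}2\pi\lambda\,g_{\mathsf L}(x)\,x,\qquad f_{X_0|E_{\mathsf N}}(x)=\frac{1}{A_{\mathsf N}}2\pi\lambda\,g_{\mathsf N}(x)\,x,\qquad x\ge0,$$ where $A_s=2\pi\lambda\int_0^\infty g_s(x)x\,dx$ and $$g_{\mathsf L}(x)=p_{\mathsf L}(x)\exp\Big(-\lambda\int_0^{2\pi}\int_0^{x}\frac{p_{\mathsf L,\mathsf L}(x,t,\theta)}{p_{\mathsf L}(x)}t\,dt\,d\theta-\lambda\int_0^{2\pi}\int_0^{e_{\mathsf N|\mathsf L}(x)}\frac{p_{\mathsf L,\mathsf N}(x,t,\theta)}{p_{\mathsf L}(x)}t\,dt\,d\theta\Big),$$ $$g_{\mathsf N}(x)=p_{\mathsf N}(x)\exp\Big(-\lambda\int_0^{2\pi}\int_0^{e_{\mathsf L|\mathsf N}(x)}\frac{p_{\mathsf N,\mathsf L}(x,t,\theta)}{p_{\mathsf N}(x)}t\,dt\,d\theta-\lambda\int_0^{2\pi}\int_0^{x}\frac{p_{\mathsf N,\mathsf N}(x,t,\theta)}{p_{\mathsf N}(x)}t\,dt\,d\theta\Big).$$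
   Context: 2D network. Base stations (BSs) form a homogeneous Poisson point process (PPP) of density $\lambda>0$ on $\mathbb R^2$; the typical user is at the origin. Blockages form an independent Boolean model of line segments: centers form a homogeneous PPP of density $\mu>0$, with i.i.d. random lengths $L$ ($0<\mathbb E[L]<\infty$) and independent orientations uniform on $[0,\pi]$; $\beta=2\mu\mathbb E[L]/\pi$. A link is the segment from the origin to a BS; it is LoS (type $\mathsf L$) if no blockage intersects it and NLoS (type $\mathsf N$) otherwise. A link of length $r$ is LoS with probability $p_{\mathsf L}(r)=e^{-\beta r}$ and NLoS with probability $p_{\mathsf N}(r)=1-e^{-\beta r}$. For two links of lengths $r_1,r_2$ with directions differing by $\theta\in[0,2\pi]$, $p_{s,v}(r_1,r_2,\theta)$ is the probability that the first is of type $s$ and the second of type $v$; thus $p_{\mathsf L,\mathsf L}$ is the probability that no blockage intersects either link, $p_{\mathsf L,\mathsf N}=e^{-\beta r_1}-p_{\mathsf L,\mathsf L}$, $p_{\mathsf N,\mathsf L}=e^{-\beta r_2}-p_{\mathsf L,\mathsf L}$, $p_{\mathsf N,\mathsf N}=1-e^{-\beta r_1}-e^{-\beta r_2}+p_{\mathsf L,\mathsf L}$. Path loss (average received power): $\ell_{\mathsf L},\ell_{\mathsf N}:[0,\infty)\to[0,\infty)$ are bounded and nonincreasing with $\ell_{\mathsf L}\ge\ell_{\mathsf N}$. Exclusion radii: $e_{\mathsf L|\mathsf L}(x)=e_{\mathsf N|\mathsf N}(x)=x$, $e_{\mathsf N|\mathsf L}(x)=\min\{y\ge0:\ell_{\mathsf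 N}(y)\le\ell_{\mathsf L}(x)\}$, $e_{\mathsf L|\mathsf N}(x)=\min\{y\ge0:\ell_{\mathsf L}(y)\le\ell_{\mathsf N}(x)\}$ (min read as infimum, $\infty$ if the set is empty). A BS of type $s$ at distance $x$ is serving iff every other BS of type $v$ is at distance greater than $e_{v|s}(x)$, for $v\in\{\mathsf L,\mathsf N\}$. First-order correlation model: for $r>0$, let $Q_r$ be the law in which there is a given BS at distance $r$, of type $s$ with probability $p_s(r)$; given that it is of type $s$, the other BSs form a PPP of density $\lambda$ and their types are mutually independent, a BS at distance $t$ whose direction makes angle $\theta$ with that of the given BS having type $v$ with probability $p_{s,v}(r,t,\theta)/p_s(r)$. Let $E_{s,r}$ be the event that the given BS is of type $s$ and is serving. In the first-order model the Palm distribution given a BS at distance $r$ is taken to be $Q_r$, so the probability that the serving BS is of type $s$ and at distance greater than $r$ is $G_s(r)=2\pi\lambda\int_r^\infty Q_x[E_{s,x}]\,x\,dx$. $E_s$ is the event that the user is served by a BS of type $s$, $A_s=\mathbb P[E_s]=G_s(0)$, and $\mathbb P[X_0>r\mid E_s]=G_s(r)/A_s$. *)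

(* Defs.v *)
From mathcomp Require Export all_boot all_order all_algebra.
From mathcomp Require Export all_classical all_reals all_analysis.
Export Order.TTheory GRing.Theory Num.Theory.
Export numFieldNormedType.Exports.

Set Implicit Arguments.
Unset Strict Implicit.
Unset Printing Implicit Defensive.

Local Open Scope classical_set_scope.
Local Open Scope ring_scope.

Definition area (R : realType) : set (R * R) -> \bar R :=
  (@lebesgue_measure R \x @lebesgue_measure R)%E.

Definition polar (R : realType) (r a : R) : R * R := (r * cos a, r * sin a).

(* The Euclidean norm; the norm that the library puts on R * R is the max
   norm. *)
Definition enorm (R : realType) (y : R * R) : R :=
  Num.sqrt (y.1 ^+ 2 + y.2 ^+ 2).

(** * Poisson point processes *)

(* A point process is given by an enumeration [X 0, X 1, ...] of its points.
   This loses nothing for the processes below, which have infinitely many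
   points almost surely. *)
Definition npoints (R : realType) (Omega : Type) (X : nat -> Omega -> R * R)
    (A : set (R * R)) (w : Omega) : \bar R :=
  (\sum_(0 <= i <oo) (\1_A (X i w))%:E)%E.

(* Unlike [poisson_pmf], which is constantly 1 at rate 0, this is the Dirac
   mass at 0 when m = 0. *)
Definition poisson_weight (R : realType) (m : R) (k : nat) : R :=
  expR (- m) * m ^+ k / k`!%:R.

Record homogeneous_PPP (R : realType) (d : measure_display)
    (Omega : measurableType d) (P : probability Omega R) (density : R)
    (X : nat -> Omega -> R * R) : Prop := {
  PPP_measurable : forall i, measurable_fun setT (X i);
  (* Counts over disjoint sets are independent Poisson variables. *)
  PPP_counts : forall (n : nat) (A : 'I_n -> set (R * R)) (k : 'I_n -> nat),
    (forall j, measurable (A j)) -> (forall j, (area (A j) < +oo)%E) ->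
    trivIset setT A ->
    P [set w | forall j, npoints X (A j) w = (k j)%:R%:E] =
      (\prod_(j < n) poisson_weight (density * fine (area (A j))) (k j))%:E
}.

(* The sigma-algebra generated by all the points. *)
Definition sigma_points (R : realType) (Omega : Type)
    (X : nat -> Omega -> R * R) : set (set Omega) :=
  <<s [set E | exists i (B : set (R * R)), measurable B /\ E = X i @^-1` B] >>.

(** * Blockages *)

Definition blockage (R : realType) (c : R * R) (l a : R) : set (R * R) :=
  [set z | exists2 u : R, `|u| <= l / 2 & z = (c.1 + u * cos a, c.2 + u * sin a)].

Definition link (R : realType) (y : R * R) : set (R * R) :=
  [set z | exists2 u : R, 0 <= u <= 1 & z = (u * y.1, u * y.2)].

Definition mean (R : realType) (law : probability (measurableTypeR R) R) :
    \bar R :=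
  (\int[law]_x x%:E)%E.

(* Segment i has centre [C i], length [Len i] and orientation [Ori i].
   [boolean_marks] says that lengths and orientations are independent of each
   other, across segments, and of all the centres. *)
Record boolean_model (R : realType) (d : measure_display)
    (Omega : measurableType d) (P : probability Omega R) (mu : R)
    (law : probability (measurableTypeR R) R)
    (C : nat -> Omega -> R * R) (Len Ori : nat -> Omega -> R) : Prop := {
  boolean_centres : homogeneous_PPP P mu C;
  boolean_Len_measurable : forall i, measurable_fun setT (Len i);
  boolean_Ori_measurable : forall i, measurable_fun setT (Ori i);
  boolean_marks : forall (F : set Omega) (n : nat) (B D : 'I_n -> set R),
    sigma_points C F ->
    (forall j, measurable (B j)) -> (forall j, measurable (D j)) ->
    P (F `&` [set w | forall j : 'I_n, B j (Len j w) /\ D j (Ori j w)]) =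
      (P F * \prod_(j < n) (law (B j) * uniform_prob (pi_gt0 R) (D j)))%E
}.

Inductive link_type := LoS | NLoS.

Definition link_is (R : realType) (Omega : Type) (C : nat -> Omega -> R * R)
    (Len Ori : nat -> Omega -> R) (s : link_type) (y : R * R) : set Omega :=
  let clear := [set w | forall i,
    blockage (C i w) (Len i w) (Ori i w) `&` link y = set0] in
  match s with LoS => clear | NLoS => ~` clear end.

Definition blockage_rate (R : realType) (mu : R)
    (law : probability (measurableTypeR R) R) : R :=
  2 * mu * fine (mean law) / pi.

Definition p1 (R : realType) (beta : R) (s : link_type) (r : R) : R :=
  match s with LoS => expR (- (beta * r)) | NLoS => 1 - expR (- (beta * r)) end.

Definition p_joint (R : realType) (d : measure_display)
    (Omega : measurableType d) (P : probability Omega R)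
    (C : nat -> Omega -> R * R) (Len Ori : nat -> Omega -> R)
    (s v : link_type) (y1 y2 : R * R) : R :=
  fine (P (link_is C Len Ori s y1 `&` link_is C Len Ori v y2)).

(* The blockages are isotropic, so the direction of the first link is
   immaterial and is taken to be 0. *)
Definition p2 (R : realType) (d : measure_display)
    (Omega : measurableType d) (P : probability Omega R)
    (C : nat -> Omega -> R * R) (Len Ori : nat -> Omega -> R)
    (s v : link_type) (r1 r2 theta : R) : R :=
  p_joint P C Len Ori s v (polar r1 0) (polar r2 theta).

(** * Path loss and exclusion radii *)

Record path_loss (R : realType) (ell : link_type -> R -> R) : Prop := {
  path_loss_ge0 : forall s x, 0 <= x -> 0 <= ell s x;
  path_loss_bounded : forall s, exists M, forall x, 0 <= x -> ell s x <= M;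
  path_loss_nonincreasing : forall s x y, 0 <= x -> x <= y ->
    ell s y <= ell s x;
  path_loss_LoS_ge : forall x, 0 <= x -> ell NLoS x <= ell LoS x
}.

(* [excl ell v s x] is e_{v|s}(x). *)
Definition excl (R : realType) (ell : link_type -> R -> R) (v s : link_type)
    (x : R) : \bar R :=
  match v, s with
  | LoS, LoS | NLoS, NLoS => x%:E
  | _, _ => ereal_inf [set y%:E | y in [set y | 0 <= y /\ ell v y <= ell s x]]
  end.

(** * First-order correlation model *)

Definition cond_law (R : realType) (d : measure_display)
    (Omega : measurableType d) (P : probability Omega R) (D : set Omega)
    (mD : measurable D) : probability Omega R :=
  mnormalize (mrestr P mD) P.

(* [M i] is the type of the point [X i].  The condition is that, given the
   points, the types are independent and the type of a point at y is v with
   probability [q v y]. *)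
Record independent_types (R : realType) (d : measure_display)
    (Omega : measurableType d) (P : probability Omega R)
    (X : nat -> Omega -> R * R) (M : nat -> Omega -> link_type)
    (q : link_type -> R * R -> R) : Prop := {
  types_measurable : forall i v, measurable [set w | M i w = v];
  types_law : forall (F : set Omega) (n : nat) (v : 'I_n -> link_type),
    sigma_points X F ->
    P (F `&` [set w | forall j : 'I_n, M j w = v j]) =
      (\int[P]_(w in F) (\prod_(j < n) q (v j) (X j w))%:E)%E
}.

(* The law of the configuration: the given BS is at [polar r 0] with type
   [T0], and the other BSs are at [X i] with types [M i].  For
   [y = polar t theta], the probability [q v y] below is
   [p2 s v r t theta / p1 s r]. *)
Record first_order_law (R : realType)
    (db : measure_display) (OmegaB : measurableType db)
    (PB : probability OmegaB R)
    (C : nat -> OmegaB -> R * R) (Len Ori : nat -> OmegaB -> R) (beta : R)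
    (d : measure_display) (Omega : measurableType d)
    (Q : probability Omega R) (lambda r : R)
    (T0 : Omega -> link_type) (X : nat -> Omega -> R * R)
    (M : nat -> Omega -> link_type) : Prop := {
  given_measurable : forall s, measurable [set w | T0 w = s];
  given_prob : forall s, Q [set w | T0 w = s] = (p1 beta s r)%:E;
  others_PPP : forall s,
    homogeneous_PPP (cond_law Q (given_measurable s)) lambda X;
  others_types : forall s,
    independent_types (cond_law Q (given_measurable s)) X M
      (fun v y => p_joint PB C Len Ori s v (polar r 0) y / p1 beta s r)
}.

(* The event that the given BS, at distance x, is of type s and serving. *)
Definition serving (R : realType) (ell : link_type -> R -> R) (Omega : Type)
    (T0 : Omega -> link_type) (X : nat -> Omega -> R * R)
    (M : nat -> Omega -> link_type) (s : link_type) (x : R) : set Omega :=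
  [set w | T0 w = s /\
    forall i v, M i w = v -> (excl ell v s x < (enorm (X i w))%:E)%E].

(* The probability that the serving BS is of type s and farther than r. *)
Definition G (R : realType) (lambda : R) (ell : link_type -> R -> R)
    (d : measure_display) (Omega : measurableType d)
    (Q : R -> probability Omega R) (T0 : Omega -> link_type)
    (X : nat -> Omega -> R * R) (M : nat -> Omega -> link_type)
    (s : link_type) (r : R) : \bar R :=
  ((2 * pi * lambda)%:E *
    \int[@lebesgue_measure R]_(x in `]r, +oo[)
      (Q x (serving ell T0 X M s x) * x%:E))%E.

(** * Densities *)

(* The integral of h(t, theta) over the disc of radius e, in polar
   coordinates. *)
Definition disc_integral (R : realType) (h : R -> R -> R) (e : \bar R) :
    \bar R :=
  (\int[@lebesgue_measure R]_(theta in `[0%R, (2 * pi)%R])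
    \int[@lebesgue_measure R]_(t in [set t : R | (0 <= t)%R /\ t%:E <= e])
      (h t theta * t)%:E)%E.

(* [expeR -oo = 0], which occurs when an exclusion radius is infinite. *)
Definition gL (R : realType) (lambda : R) (ell : link_type -> R -> R)
    (p : link_type -> R -> R)
    (pp : link_type -> link_type -> R -> R -> R -> R) (x : R) : R :=
  let hL t theta := pp LoS LoS x t theta / p LoS x in
  let hN t theta := pp LoS NLoS x t theta / p LoS x in
  p LoS x * fine (expeR
    (- (lambda%:E * disc_integral hL x%:E)
     - lambda%:E * disc_integral hN (excl ell NLoS LoS x))%E).

Definition gN (R : realType) (lambda : R) (ell : link_type -> R -> R)
    (p : link_type -> R -> R)
    (pp : link_type -> link_type -> R -> R -> R -> R) (x : R) : R :=
  let hL t theta := pp NLoS LoS x t theta / p NLoS x in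
  let hN t theta := pp NLoS NLoS x t theta / p NLoS x in
  p NLoS x * fine (expeR
    (- (lambda%:E * disc_integral hL (excl ell LoS NLoS x))
     - lambda%:E * disc_integral hN x%:E)%E).

(* f is a probability density on [0, +oo[ of a random variable Y >= 0 whose
   tail is S r = P[Y > r]. *)
Definition is_pdf (R : realType) (f : R -> R) (S : R -> R) : Prop :=
  [/\ measurable_fun (`[0, +oo[ : set R) f,
      (forall x, 0 <= x -> 0 <= f x),
      (\int[@lebesgue_measure R]_(x in `[0%R, +oo[) (f x)%:E)%E = 1%E &
      forall r, 0 <= r ->
        (S r)%:E = (\int[@lebesgue_measure R]_(x in `]r, +oo[) (f x)%:E)%E].

(* Main.v *)
Require Import Defs.
From HB Require Import structures.
From mathcomp Require Import ring lra measurable_realfun.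
Import HBNNSimple.

Set Implicit Arguments.
Unset Strict Implicit.
Unset Printing Implicit Defensive.

Local Open Scope classical_set_scope.
Local Open Scope ring_scope.

(** Given the types of the base stations, the serving event is the void event of
    a marked Poisson process, so its probability is the probability generating
    functional E prod_j (1 - h(X_j)) = exp (- lambda int h), where h y is the
    probability that a base station at y violates its exclusion radius.  The
    functional is computed for simple h from the independent Poisson counts and
    extended by monotone approximation; polar coordinates turn int h into the
    iterated integrals of the statement.  That the types at a point sum to one
    forces P(link of length x is LoS) = exp (- beta x), so the Boolean model is
    never integrated.  It enters only through the finiteness of A_N: a single
    blockage crossing all long links in a fixed cone has positive probability,
    hence g_N decays exponentially. *)

(** * Polar coordinates *)

(** The points come in an arbitrary enumeration and only the joint law of their counts is given, so
    no single [X i] has a known law. Hence expectations are taken of products over the first J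
    points, and these products are rewritten through counts before J tends to infinity.

    Given the type s of the station at distance x, the probabilities of the two types of another
    station at y sum to P(first link is of type s) / p_s(x). This number does not depend on y, so
    its expectation at one point of the process is itself, and it must equal 1.

    Finiteness of A_N is the delicate point: p_N tends to 1 at infinity, so the decay has to come
    from the exponent. There p_NN(x, t, theta) is at least P(link to (t, theta) is NLoS) - exp (-
    beta x), so for large x a lower bound on the blocking probability of a single link is enough. On
    a cone it makes the exponent grow at least linearly in x. For A_L the factor exp (- beta x)
    already suffices. *)

(** The identity on indicators passes to simple functions by linearity and to [f] by monotone
    convergence on both sides. *)
Lemma ge0_integral_density_image d1 d2 (X : measurableType d1)
    (Y : measurableType d2) (R : realType)
    (mu : {measure set X -> \bar R}) (nu : {measure set Y -> \bar R})
    (D : set X) (phi : X -> Y) (w : X -> R) (f : Y -> \bar R) :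
  measurable D -> measurable_fun D phi -> measurable_fun D w ->
  (forall x, D x -> 0 <= w x) ->
  (forall A, measurable A ->
    (\int[mu]_(x in D) (\1_A (phi x) * w x)%:E = nu A)%E) ->
  measurable_fun [set: Y] f -> (forall y, 0 <= f y)%E ->
  (\int[mu]_(x in D) (f (phi x) * (w x)%:E) = \int[nu]_y f y)%E.
Proof.
move=> mD mphi mw w0 H mf f0.
pose f_ := nnsfun_approx measurableT mf.
have mfphi n : measurable_fun D (fun x => f_ n (phi x) * w x).
  apply: measurable_funM => //; apply: (measurable_comp measurableT) => //.
transitivity (limn (fun n => \int[nu]_y (f_ n y)%:E)%E); last first.
  rewrite -monotone_convergence//.
  - apply: eq_integral => y _; apply/cvg_lim => //.
    by apply: cvg_nnsfun_approx => // *.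
  - by move=> n; exact/measurable_EFinP.
  - by move=> n y _; rewrite lee_fin.
  - by move=> y _ m n mn; rewrite lee_fin; exact/lefP/nd_nnsfun_approx.
rewrite [X in limn X](_ : _ =
    (fun n => \int[mu]_(x in D) (f_ n (phi x) * w x)%:E))%E.
  rewrite -monotone_convergence//; last 3 first.
    - by move=> n; exact/measurable_EFinP.
    - by move=> n x Dx; rewrite lee_fin mulr_ge0// w0.
    - move=> x Dx m n mn; rewrite lee_fin ler_wpM2r// ?w0//.
      exact/lefP/nd_nnsfun_approx.
  apply: eq_integral => x /[!inE] Dx /=; apply/esym/cvg_lim => //.
  under eq_fun do rewrite EFinM.
  apply: cvgeZr => //.
  by apply: cvg_nnsfun_approx => // y Dy; apply: f0; rewrite inE.
apply/funext => n.
rewrite integralT_nnsfun sintegralE.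
transitivity (\sum_(k \in range (f_ n))
    \int[mu]_(x in D) (k * \1_(f_ n @^-1` [set k]) (phi x) * w x)%:E)%E; last first.
  rewrite -ge0_integral_fsum//.
  - apply: eq_integral => x _; rewrite fsumEFin//; congr EFin.
    by rewrite (fimfunE (f_ n) (phi x)) mulr_fsuml.
  - move=> r; apply/measurable_EFinP/measurable_funM => //.
    apply: measurable_funM => //.
    by apply: (measurable_comp measurableT) => //; exact: measurable_indic.
  - move=> r x Dx; rewrite lee_fin mulr_ge0// ?w0//.
    by have := nnfun_muleindic_ge0 (f_ n) r (phi x); rewrite -EFinM lee_fin.
apply: eq_fsbigr => r; rewrite inE => -[y _ <-].
rewrite -H//.
rewrite -ge0_integralZl//; last 3 first.
- apply/measurable_EFinP/measurable_funM => //.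
  by apply: (measurable_comp measurableT) => //; exact: measurable_indic.
- by move=> x Dx; rewrite lee_fin mulr_ge0// w0.
- by rewrite lee_fin.
by apply: eq_integral => x _; rewrite -EFinM mulrA.
Qed.

(** The image under [phi] of the measure with density [w] is a Borel measure; agreeing with length
    on half-open intervals, it is the Lebesgue measure by uniqueness. Each change of variable below
    thus reduces to one computation on an interval. *)
Lemma ge0_integral_substitution d (X : measurableType d) (R : realType)
    (mu : {measure set X -> \bar R}) (D : set X) (phi : X -> measurableTypeR R)
    (w : X -> R) (f : R -> \bar R) :
  measurable D -> measurable_fun D phi -> measurable_fun D w ->
  (forall x, D x -> 0 <= w x) ->
  (forall a b : R, a < b ->
    (\int[mu]_(x in D) (\1_(`]a, b]) (phi x) * w x)%:E = (b - a)%:E)%E) ->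
  measurable_fun [set: R] f -> (forall y, 0 <= f y)%E ->
  (\int[mu]_(x in D) (f (phi x) * (w x)%:E) =
   \int[@lebesgue_measure R]_y f y)%E.
Proof.
move=> mD mphi mw w0 H mf f0.
pose nu (A : set (measurableTypeR R)) :=
  (\int[mu]_(x in D) (\1_A (phi x) * w x)%:E)%E.
have m1 A : measurable A ->
    measurable_fun D (fun x => (\1_A (phi x) * w x)%:E).
  move=> mA; apply/measurable_EFinP/measurable_funM => //.
  by apply: (measurable_comp measurableT) => //; exact: measurable_indic.
have nu0 : nu set0 = 0%E.
  by rewrite /nu integral0_eq// => x _; rewrite indicE in_set0 mul0r.
have nu_ge0 A : (0 <= nu A)%E.
  by apply: integral_ge0 => x Dx; rewrite lee_fin mulr_ge0// w0.
have nu_sa : semi_sigma_additive nu.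
  move=> /= F mF tF mUF; rewrite /nu; apply: cvg_toP.
    apply: ereal_nondecreasing_is_cvgn => m n mn.
    by apply: lee_sum_nneg_natr => // k _ _; exact: nu_ge0.
  rewrite -integral_nneseries//; last 2 first.
  - by move=> n; exact: m1.
  - by move=> n x Dx; rewrite lee_fin mulr_ge0// w0.
  apply: eq_integral => x; rewrite inE => Dx.
  under eq_eseriesr do rewrite EFinM muleC.
  rewrite nneseriesZl; last by move=> n _; rewrite lee_fin.
  by rewrite EFinM muleC (indic_bigcup (phi x) tF).
pose num := isMeasure.Build _ _ _ nu nu0 nu_ge0 nu_sa.
pose numes : {measure set (measurableTypeR R) -> \bar R} := HB.pack nu num.
apply: ge0_integral_density_image => // A mA.
rewrite -[LHS]/(numes A); apply/esym.
apply: lebesgue_measure_unique => // _ [[a b]] _ <-/=.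
rewrite lebesgue_measure_itv/= lte_fin /nu.
case: ltP => ab; first by rewrite H// EFinB.
rewrite set_itv_ge ?bnd_simp -?leNgt//.
Qed.

Lemma cos_neq0_itv (R : realType) (x : R) : x \in `](- (pi / 2)), (pi / 2)[ ->
  cos x != 0.
Proof. by move=> ?; rewrite gt_eqF// cos_gt0_pihalf// -in_itv. Qed.

Lemma measurable_tan_itv (R : realType) :
  measurable_fun (`](- (pi / 2)), (pi / 2)[ : set R) (@tan R).
Proof.
apply: open_continuous_measurable_fun => //.
by move=> x; rewrite inE/= => xI; exact/continuous_tan/cos_neq0_itv.
Qed.

(** The indicator cuts the domain down to []atan a, atan b]], where [tan] is a primitive of the
    integrand. *)
Lemma integral_tan_itv (R : realType) (a b : R) : a < b ->
  (\int[@lebesgue_measure R]_(x in `](- (pi / 2))%R, (pi / 2)%R[)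
     (\1_(`]a, b]) (tan x) * (cos x ^+ 2)^-1)%:E = (b - a)%R%:E)%E.
Proof.
move=> ab.
have I x : x \in `[atan a, atan b] -> x \in `](- (pi / 2)), (pi / 2)[.
  rewrite !in_itv/= => /andP[ax xb].
  by rewrite (lt_le_trans (atan_gtNpi2 _) ax) (le_lt_trans xb (atan_ltpi2 _)).
have tanI x : x \in `](- (pi / 2)), (pi / 2)[ ->
    (tan x \in `]a, b]) = (x \in `]atan a, atan b]).
  move=> xI; rewrite !in_itv/= -{3 4}(tanK xI).
  by rewrite (leW_mono (le_mono (@lt_atan R))) (le_mono (@lt_atan R)).
have Icos x : x \in `[atan a, atan b] -> cos x != 0.
  by move=> /I /cos_neq0_itv.
transitivity (\int[@lebesgue_measure R]_(x in `]atan a, atan b])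
    ((cos x ^+ 2)^-1)%R%:E)%E.
  rewrite integral_mkcond [RHS]integral_mkcond; apply: eq_integral => x _.
  rewrite !patchE; case: ifPn => xI.
    move: xI; rewrite inE/= => xI; rewrite indicE.
    have -> : (tan x \in (`]a, b]%classic : set R)) = (x \in `]atan a, atan b]).
      by rewrite -tanI// mem_setE.
    have -> : (x \in (`]atan a, atan b]%classic : set R)) =
        (x \in `]atan a, atan b]) by rewrite mem_setE.
    by case: (_ \in `]_, _]); rewrite ?mul1r ?mul0r.
  case: ifPn => // xJ; exfalso; move/negP: xI; apply; rewrite inE/=; apply: I.
  by move: xJ; rewrite inE/=; exact: subset_itv_oc_cc.
have mcos : measurable_fun (`]atan a, atan b] : set R)
    (fun x => ((cos x ^+ 2)^-1)%:E).
  apply: (@measurable_funS _ _ _ _ `](- (pi / 2)), (pi / 2)[) => //.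
    move=> x /= xI; apply: I; apply: subset_itv_oc_cc xI.
  apply/measurable_EFinP.
  apply: open_continuous_measurable_fun => //.
  move=> x; rewrite inE/= => xI; apply: cvgV.
    by rewrite expf_neq0// cos_neq0_itv.
  by apply: cvgM; exact: continuous_cos.
rewrite integral_itv_obnd_cbnd//.
rewrite (@continuous_FTC2 _ _ (@tan R)).
- by rewrite !atanK EFinB.
- by rewrite lt_atan.
- apply: continuous_in_subspaceT => x; rewrite inE/= => xI.
  apply: cvgV; first by rewrite expf_neq0// Icos.
  by apply: cvgM; exact: continuous_cos.
- split.
  + by move=> x xI; apply/derivable_tan/Icos; exact: subset_itv_oo_cc xI.
  + apply: cvg_at_right_filter; apply/continuous_tan/Icos.
    by rewrite in_itv/= lexx ltW// lt_atan.
  + apply: cvg_at_left_filter; apply/continuous_tan/Icos.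
    by rewrite in_itv/= lexx ltW// lt_atan.
- move=> x xI; rewrite derive1E.
  have /is_derive_tan := Icos _ (subset_itv_oo_cc xI).
  exact: (@derive_val _ _ _ _ _ _ _).
Qed.

Lemma ge0_integral_tan (R : realType) (f : R -> \bar R) :
  measurable_fun [set: R] f -> (forall y, 0 <= f y)%E ->
  (\int[@lebesgue_measure R]_(x in `](- (pi / 2))%R, (pi / 2)%R[)
     (f (tan x) * ((cos x ^+ 2)^-1)%R%:E) = \int[@lebesgue_measure R]_y f y)%E.
Proof.
move=> mf f0.
have mc : measurable_fun (`](- (pi / 2)), (pi / 2)[ : set R)
    (fun x => (cos x ^+ 2)^-1).
  apply: open_continuous_measurable_fun => //.
  move=> x; rewrite inE/= => xI; apply: cvgV.
    by rewrite expf_neq0// cos_neq0_itv.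
  by apply: cvgM; exact: continuous_cos.
apply: (@ge0_integral_substitution _ _ _ (@lebesgue_measure R) _ (@tan R)
  (fun x => (cos x ^+ 2)^-1)) => //.
- exact: measurable_tan_itv.
- by move=> x _; rewrite invr_ge0 sqr_ge0.
- by move=> a b; exact: integral_tan_itv.
Qed.

Lemma ge0_integral_affine (R : realType) (c s : R) (f : R -> \bar R) : 0 < c ->
  measurable_fun [set: R] f -> (forall y, 0 <= f y)%E ->
  (\int[@lebesgue_measure R]_x (f (c * x + s)%R * c%:E) =
   \int[@lebesgue_measure R]_y f y)%E.
Proof.
move=> c0 mf f0.
apply: (@ge0_integral_substitution _ _ _ (@lebesgue_measure R) setT
  (fun x => c * x + s) (cst c)) => //.
- by apply: measurable_funD => //; exact: measurable_funM.
- by move=> *; rewrite ltW.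
move=> a b ab.
transitivity (\int[@lebesgue_measure R]_(x in
    `]((a - s) / c)%R, ((b - s) / c)%R]) c%:E)%E.
  rewrite [RHS]integral_mkcond; apply: eq_integral => x _.
  rewrite patchE indicE !mem_setE !in_itv/= ltr_pdivrMr// ler_pdivlMr//.
  rewrite (mulrC x) ltrBlDr lerBrDr.
  by case: (_ && _); rewrite ?mul1r ?mul0r.
rewrite integral_cst//= lebesgue_measure_itv/= lte_fin ltr_pM2r ?invr_gt0//.
rewrite ltrD2r ab -EFinB -EFinM; congr EFin; field; lra.
Qed.

Lemma ge0_integral_opp (R : realType) (f : R -> \bar R) :
  measurable_fun [set: R] f -> (forall y, 0 <= f y)%E ->
  (\int[@lebesgue_measure R]_x f (- x)%R = \int[@lebesgue_measure R]_y f y)%E.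
Proof.
move=> mf f0; transitivity (\int[@lebesgue_measure R]_x (f (- x)%R * 1%:E))%E.
  by apply: eq_integral => x _; rewrite mule1.
apply: (@ge0_integral_substitution _ _ _ (@lebesgue_measure R) setT
  (fun x => - x) (cst 1)) => //; first exact: measurableT_comp.
move=> a b ab.
transitivity (\int[@lebesgue_measure R]_(x in `[(- b)%R, (- a)%R[) 1)%E.
  rewrite [RHS]integral_mkcond; apply: eq_integral => x _.
  rewrite patchE indicE !mem_setE !in_itv/= mulr1 lerNl ltrNr andbC.
  by case: (_ && _).
by rewrite integral_cst//= lebesgue_measure_itv/= lte_fin ltrN2 ab -EFinB mul1e
  opprK addrC.
Qed.

(** Inversion is continuous off 0, and the single point 0, where its value is 0 by convention, is
    treated apart. *)
Lemma measurable_invr (R : realType) :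
  measurable_fun [set: R] (fun x : R => x^-1).
Proof.
have mU : measurable ([set x | x != 0] : set R).
  by rewrite (_ : [set x | _] = ~` [set 0]);
    [exact: measurableC|apply/seteqP; split => x /= /eqP].
rewrite (_ : setT = [set x | x != 0] `|` [set 0]); last first.
  by apply/seteqP; split => x //= _; case: eqVneq; [right|left].
apply/measurable_funU => //; split.
  apply: open_continuous_measurable_fun.
    rewrite (_ : [set x | _] = ~` [set 0]).
      by rewrite openC; exact: closed_eq.
    by apply/seteqP; split => x /= /eqP.
  by move=> x; rewrite inE/= => x0; exact: inv_continuous.
exact: measurable_fun_set1.
Qed.

(** Extending [h] by 0 outside [A * B] reduces this to Tonelli. Positivity is asked on the rectangle
    only, because the Jacobians used below change sign outside it. *)
Lemma ge0_fubini_in d1 d2 (T1 : measurableType d1) (T2 : measurableType d2)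
    (R : realType) (m1 : {sigma_finite_measure set T1 -> \bar R})
    (m2 : {sigma_finite_measure set T2 -> \bar R}) (A : set T1) (B : set T2)
    (h : T1 * T2 -> \bar R) :
  measurable A -> measurable B -> measurable_fun [set: (T1 * T2)%type] h ->
  (forall x y, A x -> B y -> 0 <= h (x, y))%E ->
  (\int[m1]_(x in A) \int[m2]_(y in B) h (x, y) =
   \int[m2]_(y in B) \int[m1]_(x in A) h (x, y))%E.
Proof.
move=> mA mB mh h0; pose h' := h \_ (A `*` B).
have mh' : measurable_fun [set: (T1 * T2)%type] h'.
  by apply/(measurable_restrictT _ (measurableX mA mB)); exact: measurable_funS mh.
have h'0 z : (0 <= h' z)%E.
  rewrite /h' patchE; case: ifPn => //; rewrite inE; case: z => x y [/=].
  exact: h0.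
rewrite integral_mkcond [RHS]integral_mkcond.
transitivity (\int[m1]_x \int[m2]_y h' (x, y))%E.
  apply: eq_integral => x _; rewrite patchE; case: ifPn => xA.
    rewrite integral_mkcond; apply: eq_integral => y _.
    by rewrite /h' !patchE in_setX xA.
  by rewrite integral0_eq// => y _; rewrite /h' patchE in_setX (negbTE xA).
rewrite fubini_tonelli//; apply: eq_integral => y _; rewrite patchE.
case: ifPn => yB.
  rewrite [RHS]integral_mkcond; apply: eq_integral => x _.
  by rewrite /h' !patchE in_setX yB andbT.
by rewrite integral0_eq// => x _; rewrite /h' patchE in_setX (negbTE yB) andbF.
Qed.

Lemma measurable_polar (R : realType) :
  measurable_fun [set: (R * R)%type] (fun z : R * R => polar z.1 z.2).
Proof.
by apply: measurable_fun_pair; apply: measurable_funM => //;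
  apply: measurableT_comp => //; apply: continuous_measurable_fun;
  [exact: continuous_cos|exact: continuous_sin].
Qed.

Lemma measurable_tan (R : realType) : measurable_fun [set: R] (@tan R).
Proof.
apply: measurable_funM.
  by apply: continuous_measurable_fun; exact: continuous_sin.
apply: (measurableT_comp (@measurable_invr R)).
by apply: continuous_measurable_fun; exact: continuous_cos.
Qed.

(** Two substitutions in one variable replace a planar one: y = x tan a at fixed x > 0, then, after
    exchanging the integrals, x = t cos a at fixed a. The Jacobians x / cos^2 a and cos a multiply
    to t. *)
Lemma ge0_integral_half_plane (R : realType) (f : R * R -> \bar R) :
  measurable_fun [set: (R * R)%type] f -> (forall y, 0 <= f y)%E ->
  (\int[@lebesgue_measure R]_(x in `]0%R, +oo[)
     \int[@lebesgue_measure R]_y f (x, y) =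
   \int[@lebesgue_measure R]_(a in `](- (pi / 2))%R, (pi / 2)%R[)
     \int[@lebesgue_measure R]_(t in `]0%R, +oo[) (f (polar t a) * t%:E))%E.
Proof.
move=> mf f0.
pose h (z : R * R) :=
  (f (z.1, z.1 * tan z.2)%R * (z.1 * (cos z.2 ^+ 2)^-1)%R%:E)%E.
have mh : measurable_fun [set: (R * R)%type] h.
  apply: emeasurable_funM.
    apply: (measurableT_comp mf); apply: measurable_fun_pair => //.
    apply: measurable_funM => //.
    exact: (measurableT_comp (@measurable_tan R)).
  apply/measurable_EFinP; apply: measurable_funM => //.
  apply: (measurableT_comp (@measurable_invr R)).
  apply: measurable_funX; apply: measurableT_comp => //.
  by apply: continuous_measurable_fun; exact: continuous_cos.
have mfx x : measurable_fun [set: R] (fun y => f (x, y)).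
  exact: measurable_fun_pair2.
transitivity (\int[@lebesgue_measure R]_(x in `]0%R, +oo[)
    \int[@lebesgue_measure R]_(a in `](- (pi / 2))%R, (pi / 2)%R[) h (x, a))%E.
  apply: eq_integral => x; rewrite inE/= in_itv/= andbT => x0.
  rewrite -(ge0_integral_affine 0 x0 (mfx x))//.
  rewrite -ge0_integral_tan; last 2 first.
  - apply: emeasurable_funM => //; apply: (measurableT_comp (mfx x)).
    by apply: measurable_funD => //; exact: measurable_funM.
  - by move=> y; rewrite mule_ge0// lee_fin ltW.
  by apply: eq_integral => a _; rewrite /h/= addr0 EFinM muleA.
have h0 x y : `]0, +oo[%classic x -> `](- (pi / 2)), (pi / 2)[%classic y ->
    (0 <= h (x, y))%E.
  rewrite /= in_itv/= andbT => x0 _.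
  by rewrite mule_ge0// lee_fin mulr_ge0 ?invr_ge0 ?sqr_ge0// ltW.
have := @ge0_fubini_in _ _ (measurableTypeR R) (measurableTypeR R) R
  (@lebesgue_measure R) (@lebesgue_measure R) _ _ h (measurable_itv _)
  (measurable_itv _) mh h0.
move=> ->.
apply: eq_integral => a; rewrite inE/= => /[dup] aI /cos_neq0_itv ca.
have ca0 : 0 < cos a by rewrite cos_gt0_pihalf// -in_itv.
(* Extension by 0 turns the half-line into the whole line, where scaling applies; since cos a > 0
   the condition 0 < x becomes 0 < t. *)
pose F (x : R) := if 0 < x then h (x, a) else 0%E.
have FE : (fun x => h (x, a)) \_ `]0%R, +oo[ = F.
  by apply/funext => x; rewrite patchE mem_setE in_itv/= andbT.
have mF : measurable_fun [set: R] F.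
  rewrite -FE; apply/(measurable_restrictT _ _).1 => //.
  by apply: measurable_funTS; exact: measurable_fun_pair1.
rewrite integral_mkcond FE -(ge0_integral_affine 0 ca0 mF); last first.
  move=> y; rewrite /F; case: ifPn => // y0.
  by rewrite mule_ge0// lee_fin mulr_ge0 ?invr_ge0 ?sqr_ge0// ltW.
rewrite [RHS]integral_mkcond; apply: eq_integral => t _.
rewrite patchE mem_setE in_itv/= andbT /F addr0 pmulr_rgt0//.
case: ifPn => t0; last by rewrite mul0e.
rewrite /h/= -muleA -EFinM /polar; congr (f _ * _%:E)%E.
  by congr pair; [rewrite mulrC|rewrite /tan; field].
by field.
Qed.

Lemma measurable_fun_integral_in d1 d2 (T1 : measurableType d1)
    (T2 : measurableType d2) (R : realType)
    (m2 : {sigma_finite_measure set T2 -> \bar R}) (B : set T2)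
    (h : T1 * T2 -> \bar R) :
  measurable B -> measurable_fun [set: (T1 * T2)%type] h ->
  (forall x y, B y -> 0 <= h (x, y))%E ->
  measurable_fun [set: T1] (fun x => \int[m2]_(y in B) h (x, y))%E.
Proof.
move=> mB mh h0.
have mTB : measurable ([set: T1] `*` B) by exact: measurableX.
rewrite (_ : (fun _ => _) = fubini_F m2 (h \_ ([set: T1] `*` B))).
  apply: measurable_fun_fubini_tonelli_F.
    by apply/(measurable_restrictT _ mTB); exact: measurable_funS mh.
  move=> z; rewrite patchE; case: ifPn => //; rewrite inE; case: z => x y [/= _].
  exact: h0.
apply/funext => x; rewrite /fubini_F [LHS]integral_mkcond.
by apply: eq_integral => y _; rewrite !patchE in_setX in_setT.
Qed.

Lemma ge0_integral_itv_shift (R : realType) (a b s : R) (g : R -> \bar R) :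
  measurable_fun [set: R] g -> (forall y, 0 <= g y)%E ->
  (\int[@lebesgue_measure R]_(x in `[a, b[) g (x + s)%R =
   \int[@lebesgue_measure R]_(x in `[(a + s)%R, (b + s)%R[) g x)%E.
Proof.
move=> mg g0; pose g' := g \_ (`[a + s, b + s[ : set R).
have mg' : measurable_fun [set: R] g'.
  apply/(measurable_restrictT _ _).1 => //.
  exact: measurable_funS mg.
rewrite [RHS]integral_mkcond -(ge0_integral_affine s ltr01 mg').
  rewrite integral_mkcond; apply: eq_integral => x _.
  by rewrite /g' !patchE !mem_setE !in_itv/= mul1r mule1 lerD2r ltrD2r.
by move=> y; rewrite /g' patchE; case: ifPn.
Qed.

Lemma ge0_integral_itv_split (R : realType) (a b c : R) (g : R -> \bar R) :
  measurable_fun [set: R] g -> (forall y, 0 <= g y)%E -> a <= b -> b <= c ->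
  (\int[@lebesgue_measure R]_(x in `[a, c[) g x =
   \int[@lebesgue_measure R]_(x in `[a, b[) g x +
   \int[@lebesgue_measure R]_(x in `[b, c[) g x)%E.
Proof.
move=> mg g0 ab bc.
rewrite (@itv_bndbnd_setU _ _ _ (BLeft b)) ?bnd_simp//.
rewrite ge0_integral_setU//; first exact: measurable_funS mg.
apply/disj_setPS => x [/=]; rewrite !in_itv/= => /andP[_ xb] /andP[bx _].
by have := lt_le_trans xb bx; rewrite ltxx.
Qed.

(** The right half-plane uses the angles between -pi/2 and pi/2 and the left one their shift by pi.
    Together they make up a full period up to endpoints, which are negligible. *)
Lemma ge0_integral_periodic (R : realType) (H : R -> \bar R) :
  measurable_fun [set: R] H -> (forall y, 0 <= H y)%E ->
  (forall a, H (a + 2 * pi) = H a) ->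
  (\int[@lebesgue_measure R]_(a in `](- (pi / 2))%R, (pi / 2)%R[) H a +
    \int[@lebesgue_measure R]_(a in `](- (pi / 2))%R, (pi / 2)%R[) H (a + pi)%R =
   \int[@lebesgue_measure R]_(a in `[0%R, (2 * pi)%R]) H a)%E.
Proof.
move=> mH H0 H2pi; have pi0 := @pi_gt0 R.
have mHpi : measurable_fun [set: R] (fun a => H (a + pi)).
  by apply: (measurableT_comp mH); exact: measurable_funD.
have oc (k : R -> \bar R) (a b : R) : measurable_fun [set: R] k ->
    (\int[@lebesgue_measure R]_(x in `]a, b[) k x =
     \int[@lebesgue_measure R]_(x in `[a, b[) k x)%E.
  by move=> mk; apply: integral_itv_obnd_cbnd; exact: measurable_funS mk.
rewrite !oc// ge0_integral_itv_shift//.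
rewrite -integral_itv_bndo_bndc; last exact: measurable_funS mH.
rewrite (@ge0_integral_itv_split _ (- (pi / 2)) 0 (pi / 2))//; last 2 first.
- lra.
- lra.
(* The angles below 0 move by one period to the interval from 3 pi / 2 to 2 pi. *)
have <- : (\int[@lebesgue_measure R]_(x in
    `[(- (pi / 2) + 2 * pi)%R, (0 + 2 * pi)%R[) H x =
    \int[@lebesgue_measure R]_(x in `[(- (pi / 2))%R, 0%R[) H x)%E.
  by rewrite -ge0_integral_itv_shift//; apply: eq_integral => x _.
set J := fun a b : R => (\int[@lebesgue_measure R]_(x in `[a, b[) H x)%E.
change ((J (- (pi / 2) + 2 * pi)%R (0 + 2 * pi)%R + J 0%R (pi / 2)%R +
  J (- (pi / 2) + pi)%R (pi / 2 + pi)%R)%E = J 0%R (2 * pi)%R).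
have JD a b c : a <= b -> b <= c -> J a c = (J a b + J b c)%E.
  exact: ge0_integral_itv_split.
rewrite (JD 0 (pi / 2) (2 * pi)); [|lra|lra].
rewrite (JD (pi / 2) (- (pi / 2) + 2 * pi) (2 * pi)); [|lra|lra].
rewrite (_ : pi / 2 + pi = - (pi / 2) + 2 * pi); last by field.
rewrite (_ : - (pi / 2) + pi = pi / 2); last by field.
by rewrite add0r -addeA addeC addeA.
Qed.

Lemma ge0_integral_polar (R : realType) (f : R * R -> \bar R) :
  measurable_fun [set: (R * R)%type] f -> (forall y, 0 <= f y)%E ->
  (\int[(@lebesgue_measure R \x @lebesgue_measure R)%E]_y f y =
   \int[@lebesgue_measure R]_(a in `[0%R, (2 * pi)%R])
     \int[@lebesgue_measure R]_(t in `]0%R, +oo[) (f (polar t a) * t%:E))%E.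
Proof.
move=> mf f0.
pose g x := (\int[@lebesgue_measure R]_y f (x, y))%E.
have mg : measurable_fun [set: R] g by exact: measurable_fun_fubini_tonelli_F.
have g0 x : (0 <= g x)%E by exact: integral_ge0.
(* Central symmetry carries the left half-plane to the right one and adds pi to the angle. *)
pose f' (z : R * R) := f (- z.1, - z.2).
have mf' : measurable_fun [set: (R * R)%type] f'.
  by apply: (measurableT_comp mf); apply: measurable_fun_pair => //;
    exact: measurableT_comp.
pose H a := (\int[@lebesgue_measure R]_(t in `]0%R, +oo[)
  (f (polar t a) * t%:E))%E.
have mH : measurable_fun [set: R] H.
  apply: (@measurable_fun_integral_in _ _ (measurableTypeR R) (measurableTypeR R)
    R (@lebesgue_measure R) _
    (fun z : R * R => f (polar z.2 z.1) * (z.2)%:E)%E) => //.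
    apply: emeasurable_funM; last exact/measurable_EFinP.
    apply: (measurableT_comp mf).
    apply: (measurableT_comp (@measurable_polar R)
      (g := fun z : R * R => (z.2, z.1))).
    exact: measurable_fun_pair.
  by move=> a t /=; rewrite in_itv/= andbT => t0; rewrite mule_ge0// lee_fin ltW.
have H0 a : (0 <= H a)%E.
  apply: integral_ge0 => t /=; rewrite in_itv/= andbT => t0.
  by rewrite mule_ge0// lee_fin ltW.
have Hpi a : H (a + pi) = (\int[@lebesgue_measure R]_(t in `]0%R, +oo[)
  (f' (polar t a) * t%:E))%E.
  by apply: eq_integral => t _; rewrite /f' /polar/= cosDpi sinDpi !mulrN.
have H2pi a : H (a + 2 * pi) = H a.
  apply: eq_integral => t _; rewrite /polar mulr_natl mulr2n addrA.
  by rewrite !cosDpi !sinDpi !opprK.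
have pi0 := @pi_gt0 R.
transitivity (\int[@lebesgue_measure R]_x g x)%E; first exact: fubini_tonelli1.
have -> : (\int[@lebesgue_measure R]_x g x =
    \int[@lebesgue_measure R]_(x in `]0%R, +oo[) g x +
    \int[@lebesgue_measure R]_(x in `]0%R, +oo[) g (- x)%R)%E.
  have -> : (setT : set R) = `]-oo, 0%R] `|` `]0%R, +oo[.
    by rewrite -itv_bndbnd_setU// set_itvNyy.
  rewrite ge0_integral_setU//; last 2 first.
  - exact: measurable_funS mg.
  - apply/disj_setPS => x [/=]; rewrite !in_itv/= andbT => x0 /(le_lt_trans x0).
    by rewrite ltxx.
  rewrite addeC; congr adde.
  have mgN : measurable_fun [set: R] (fun x => g (- x)).
    exact: (measurableT_comp mg (@oppr_measurable R setT)).
  rewrite integral_itv_obnd_cbnd; last exact: measurable_funS mgN.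
  rewrite ge0_integration_by_substitution0//.
  by apply: eq_integral => x _; rewrite opprK.
rewrite ge0_integral_half_plane//.
have -> : (\int[@lebesgue_measure R]_(x in `]0%R, +oo[) g (- x)%R =
    \int[@lebesgue_measure R]_(x in `]0%R, +oo[)
      \int[@lebesgue_measure R]_y f' (x, y))%E.
  apply: eq_integral => x _; rewrite /g -ge0_integral_opp//.
  exact: measurable_fun_pair2.
rewrite ge0_integral_half_plane//; last by move=> y; exact: f0.
transitivity (
    \int[@lebesgue_measure R]_(a in `](- (pi / 2))%R, (pi / 2)%R[) H a +
    \int[@lebesgue_measure R]_(a in `](- (pi / 2))%R, (pi / 2)%R[) H (a + pi)%R)%E.
  by congr adde; apply: eq_integral => a _; rewrite Hpi.
exact: ge0_integral_periodic.
Qed.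

(** * Poisson point processes *)

Definition count_points (R : realType) (Omega : Type) (X : nat -> Omega -> R * R)
    (J : nat) (A : set (R * R)) (w : Omega) : nat :=
  (\sum_(i < J) (X i w \in A))%N.

Lemma count_points_nd (R : realType) (Omega : Type)
    (X : nat -> Omega -> R * R) (A : set (R * R)) (w : Omega) :
  {homo (count_points X)^~ A^~ w : m n / (m <= n)%N}.
Proof.
apply: (homo_leq (leqnn)) => [y x z|n]; first exact: leq_trans.
by rewrite /count_points big_ord_recr leq_addr.
Qed.

Lemma npoints_cvg (R : realType) (Omega : Type)
    (X : nat -> Omega -> R * R) (A : set (R * R)) (w : Omega) :
  ((count_points X J A w)%:R%:E : \bar R) @[J --> \oo] --> npoints X A w.
Proof.
rewrite (_ : (fun J => _) =
    (fun J => (\sum_(0 <= i < J) (\1_A (X i w))%:E)%E : \bar R)).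
  by apply: is_cvg_nneseries => i _ _; rewrite lee_fin.
apply/funext => J; rewrite big_mkord sumEFin /count_points natr_sum.
by congr EFin; apply: eq_bigr => i _; rewrite indicE.
Qed.

(** Partial counts are nondecreasing integers: bounded, they are eventually constant; unbounded,
    they tend to infinity. The infinite case has to be kept, since the Poisson masses are prescribed
    for finite counts only. *)
Lemma count_points_dichotomy (R : realType) (Omega : Type)
    (X : nat -> Omega -> R * R) (A : set (R * R)) (w : Omega) :
  (exists n, (\forall J \near \oo, count_points X J A w = n) /\
     npoints X A w = n%:R%:E) \/
  ((forall n, \forall J \near \oo, (n <= count_points X J A w)%N) /\
     npoints X A w = +oo%E).
Proof.
have npointsE l : ((count_points X J A w)%:R%:E : \bar R) @[J --> \oo] --> l ->
    npoints X A w = l.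
  move=> cl; have nl := @npoints_cvg _ _ X A w.
  by rewrite -(cvg_lim _ cl)// (cvg_lim _ nl).
have [[n Hn]|H] := pselect (exists n, forall J, (count_points X J A w <= n)%N).
  left; pose P n := `[< exists J, count_points X J A w = n >].
  have exP : exists i, P i.
    by exists (count_points X 0 A w); apply/asboolP; exists 0%N.
  have ubP i : P i -> (i <= n)%N by move=> /asboolP[J <-].
  case: (ex_maxnP exP ubP) => m /asboolP[J Jm] mub; exists m.
  have near_m : \forall J \near \oo, count_points X J A w = m.
    exists J => // K /= JK; apply/eqP; rewrite eqn_leq; apply/andP; split.
      by apply: mub; apply/asboolP; exists K.
    by rewrite -Jm; exact: count_points_nd.
  split => //; apply: npointsE.
  apply: cvg_near_cst; near=> K; congr (_%:R%:E).
  by near: K.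
right.
have Hn n : \forall J \near \oo, (n <= count_points X J A w)%N.
  have [J nJ] : exists J, (n < count_points X J A w)%N.
    by apply/not_existsP => HJ; apply: H; exists n => J; rewrite leqNgt; apply/negP.
  exists J => // K /= /(@count_points_nd _ _ X A w); apply: leq_trans; exact: ltnW.
split => //; apply: npointsE.
apply/cvgeyPge => r; near=> J; rewrite lee_fin.
apply: (@le_trans _ _ (Num.truncn r).+1%:R).
  by rewrite ltW// truncnS_gt.
by rewrite ler_nat; near: J; exact: Hn.
Unshelve. all: by end_near. Qed.

(** This is b^N(A). Taking the limit of partial powers gives it a meaning for an infinite count as
    well, with value 0 when 0 <= b < 1. *)
Definition pow_count (R : realType) (Omega : Type) (X : nat -> Omega -> R * R)
    (b : R) (A : set (R * R)) (w : Omega) : R :=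
  limn (fun J => b ^+ count_points X J A w).

(** At most one term of the series is nonzero, the one whose index is the count. For an infinite
    count all terms vanish, and so does the limit because b < 1; at b = 1 the two sides would differ
    there. *)
Lemma pow_countE (R : realType) (Omega : Type) (X : nat -> Omega -> R * R)
    (b : R) (A : set (R * R)) (w : Omega) : 0 <= b < 1 ->
  (b ^+ count_points X J A w) @[J --> \oo] --> pow_count X b A w /\
  (pow_count X b A w)%:E =
    (\sum_(0 <= m <oo) (b ^+ m * \1_[set w | npoints X A w = m%:R%:E] w)%:E)%E.
Proof.
move=> /andP[b0 b1].
have cvgP l : (b ^+ count_points X J A w) @[J --> \oo] --> l ->
    (l%:E = \sum_(0 <= m <oo)
      (b ^+ m * \1_[set w | npoints X A w = m%:R%:E] w)%:E)%E ->
  (b ^+ count_points X J A w) @[J --> \oo] --> pow_count X b A w /\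
  (pow_count X b A w)%:E =
    (\sum_(0 <= m <oo) (b ^+ m * \1_[set w | npoints X A w = m%:R%:E] w)%:E)%E.
  by move=> cl ls; rewrite /pow_count (cvg_lim _ cl).
case: (count_points_dichotomy X A w) => [[n [nn Nn]]|[nn Nn]].
  apply: (cvgP (b ^+ n)).
    by apply: cvg_near_cst; near=> J; congr (_ ^+ _); near: J.
  rewrite (@nneseriesD1 _ _ n)//; last first.
    by move=> m _; rewrite lee_fin mulr_ge0// exprn_ge0.
  rewrite indicE mem_set//= mulr1 eseries0 ?adde0// => m _ mn.
  rewrite indicE memNset ?mulr0//= Nn => -[/eqP].
  by rewrite eqr_nat eq_sym (negbTE mn).
apply: (cvgP 0).
  have := @cvg_expr R b; rewrite ger0_norm// => /(_ b1) bn.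
  apply/cvgrPdist_le => e e0.
  move/cvgrPdist_le : bn => /(_ _ e0)[n _ /(_ n (leqnn n))].
  rewrite !sub0r !normrN ger0_norm ?exprn_ge0// => bne.
  near=> J; rewrite sub0r normrN ger0_norm ?exprn_ge0//.
  apply: le_trans bne; apply: ler_wiXn2l => //; first exact: ltW.
  by near: J; exact: nn.
by rewrite eseries0// => m _ _; rewrite indicE memNset ?mulr0//= Nn.
Unshelve. all: by end_near. Qed.

Lemma poisson_series (R : realType) (b c : R) :
  (\sum_(0 <= m <oo) (b ^+ m * poisson_weight c m)%:E)%E =
    (expR (- (c * (1 - b))))%:E.
Proof.
apply/cvg_lim => //.
rewrite (_ : (fun n => _) =
    EFin \o (fun n => expR (- c) * series (exp_coeff (b * c)) n)).
  apply/cvg_EFin; first by near=> n.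
  rewrite (_ : - (c * (1 - b)) = - c + b * c); last by ring.
  by rewrite expRD; apply: cvgZl_tmp; exact: is_cvg_series_exp_coeff.
apply/funext => n /=; rewrite sumEFin /series/= mulr_sumr; congr EFin.
apply: eq_bigr => i _; rewrite /exp_coeff/= /poisson_weight exprMn.
by rewrite !mulrA; congr (_ * _); ring.
Unshelve. all: by end_near. Qed.

(** This is the passage between functions of counts, whose law is known, and products over points,
    which the thinning produces. *)
Lemma expr_count_points (R : realType) (Omega : Type)
    (X : nat -> Omega -> R * R) (b : R) (J : nat) (A : set (R * R)) (w : Omega) :
  b ^+ count_points X J A w = \prod_(i < J) (1 - (1 - b) * \1_A (X i w)).
Proof.
rewrite /count_points (big_morph _ (exprD b) (expr0 b)).
apply: eq_bigr => i _; rewrite indicE.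
by case: (_ \in _); rewrite /= ?expr1 ?expr0 ?mulr1 ?mulr0; ring.
Qed.

Section poisson_process.
Context (R : realType) (d : measure_display) (Omega : measurableType d)
  (P : probability Omega R) (lambda : R) (X : nat -> Omega -> R * R)
  (lambda0 : 0 < lambda) (PX : homogeneous_PPP P lambda X).

Lemma measurable_indic_point (A : set (R * R)) (i : nat) : measurable A ->
  measurable_fun setT (fun w => \1_A (X i w) : R).
Proof.
move=> mA; apply: measurableT_comp; last exact: PPP_measurable PX i.
exact: measurable_indic.
Qed.

Lemma measurable_expr_count_points (b : R) (J : nat) (A : set (R * R)) :
  measurable A -> measurable_fun setT (fun w => b ^+ count_points X J A w).
Proof.
move=> mA; under eq_fun do rewrite expr_count_points.
apply: measurable_prod => i _; apply: measurable_funB => //.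
by apply: measurable_funM => //; exact: measurable_indic_point.
Qed.

Lemma measurable_npoints_eq (A : set (R * R)) (m : nat) : measurable A ->
  measurable [set w | npoints X A w = m%:R%:E].
Proof.
move=> mA; have mN : measurable_fun setT (npoints X A).
  apply: ge0_emeasurable_sum => i; first by move=> w _ _; rewrite lee_fin.
  by move=> _; apply/measurable_EFinP; exact: measurable_indic_point.
rewrite (_ : [set w | _] = setT `&` npoints X A @^-1` [set m%:R%:E]).
  exact: mN.
by rewrite setTI.
Qed.

Lemma measurable_pow_count (b : R) (A : set (R * R)) : 0 <= b < 1 ->
  measurable A -> measurable_fun setT (pow_count X b A).
Proof.
move=> b01 mA.
apply: (@measurable_fun_cvg _ _ _ setT (fun J w => b ^+ count_points X J A w)).
  by move=> J; exact: measurable_expr_count_points.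
by move=> w _; exact: (pow_countE X A w b01).1.
Qed.

Lemma pow_count_ge0 (b : R) (A : set (R * R)) w : 0 <= b < 1 ->
  0 <= pow_count X b A w.
Proof.
move=> b01; have [c _] := pow_countE X A w b01.
have b0 : 0 <= b by case/andP: b01.
rewrite /pow_count; apply: limr_ge; first by apply/cvg_ex; eexists; exact: c.
by near=> J; rewrite exprn_ge0.
Unshelve. all: by end_near. Qed.

(** The induction is on the number l of indices already transformed: [F l] has the factor b_j^N(A_j)
    for j < l and the indicator of N(A_j) = k_j for the others. Stage 0 is the joint Poisson law.
    Multiplying stage l by b_l^m and summing over the value m of the l-th count gives stage l +
    1. *)
Lemma poisson_pgf (n : nat) (A : 'I_n -> set (R * R)) (b : 'I_n -> R) :
  (forall j, measurable (A j)) -> (forall j, (area (A j) < +oo)%E) ->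
  trivIset setT A -> (forall j, 0 <= b j < 1) ->
  (\int[P]_w (\prod_j pow_count X (b j) (A j) w)%:E =
   (\prod_j expR (- (lambda * fine (area (A j)) * (1 - b j))))%:E)%E.
Proof.
move=> mA Afin tA b01.
pose F (l : nat) (k : 'I_n -> nat) w (j : 'I_n) : R :=
  if (j < l)%N then pow_count X (b j) (A j) w
  else \1_[set w | npoints X (A j) w = (k j)%:R%:E] w.
pose V (l : nat) (k : 'I_n -> nat) (j : 'I_n) : R :=
  if (j < l)%N then expR (- (lambda * fine (area (A j)) * (1 - b j)))
  else poisson_weight (lambda * fine (area (A j))) (k j).
have F0 l k w j : 0 <= F l k w j.
  by rewrite /F; case: ifPn => // _; exact: pow_count_ge0.
have mF l k : measurable_fun setT (fun w => \prod_j F l k w j).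
  apply: measurable_prod => j _; rewrite /F; case: (j < l)%N.
    exact: measurable_pow_count.
  exact/measurable_indic/measurable_npoints_eq.
suff H l k : (l <= n)%N ->
    (\int[P]_w (\prod_j F l k w j)%:E = (\prod_j V l k j)%:E)%E.
  have := H n (fun=> 0%N) (leqnn n).
  under eq_integral do under eq_bigr do rewrite /F ltn_ord.
  by under [in RHS]eq_bigr do rewrite /V ltn_ord.
elim: l k => [k _|l IH k ln].
  rewrite -(PPP_counts PX k mA Afin tA).
  have mk : measurable [set w | forall j, npoints X (A j) w = (k j)%:R%:E].
    rewrite (_ : [set w | _] = \bigcap_(j in [set: 'I_n])
        [set w | npoints X (A j) w = (k j)%:R%:E]); last first.
      by apply/seteqP; split=> [w /= H j _|w H j]; [exact: H|exact: (H j I)].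
    by apply: fin_bigcap_measurable => // j _; exact: measurable_npoints_eq.
  transitivity (\int[P]_w (\1_[set w | forall j, npoints X (A j) w = (k j)%:R%:E]
    w)%:E)%E; last by rewrite integral_indic// setIT.
  apply: eq_integral => w _.
  congr EFin; rewrite /F indicE.
  case: (boolP (w \in _)) => [|/negP]; rewrite inE => wk.
    by rewrite big1// => j _; rewrite ?ltn0 indicE mem_set//=.
  apply/eqP/prodf_eq0.
  have /existsNP[j wj] : ~ forall j, npoints X (A j) w = (k j)%:R%:E by [].
  by exists j => //; rewrite ?ltn0 indicE memNset.
pose i := Ordinal ln.
(* The induction hypothesis is used at every count vector that differs from [k] at the index [i]
   only. *)
pose upd (m : nat) (j : 'I_n) := if j == i then m else k j.
have neq_i (j : 'I_n) : j != i -> (j < l.+1)%N = (j < l)%N.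
  by move=> ji; rewrite ltnS leq_eqVlt (_ : (val j == l) = false)//; apply/negbTE.
have FE w : (\prod_j F l.+1 k w j)%:E = (\sum_(0 <= m <oo)
    (b i ^+ m * \prod_j F l (upd m) w j)%:E)%E.
  rewrite (bigD1 i)//= {1}/F ltnSn EFinM (pow_countE X (A i) w (b01 i)).2.
  rewrite muleC -nneseriesZl; last first.
    by move=> m _; rewrite lee_fin mulr_ge0// exprn_ge0//; case/andP: (b01 i).
  apply: eq_eseriesr => m _; rewrite -EFinM; congr EFin.
  rewrite [in RHS](bigD1 i)//= {2}/F ltnn /upd eqxx mulrC -mulrA.
  congr (_ * (_ * _)).
  by apply: eq_bigr => j ji; rewrite /F neq_i// (negbTE ji).
have VE m : \prod_j V l (upd m) j =
    poisson_weight (lambda * fine (area (A i))) m * \prod_(j | j != i) V l k j.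
  rewrite (bigD1 i)//= {1}/V ltnn /upd eqxx; congr (_ * _).
  by apply: eq_bigr => j ji; rewrite /V (negbTE ji).
under eq_integral do rewrite FE.
have b0 : 0 <= b i by case/andP: (b01 i).
rewrite integral_nneseries//; last 2 first.
- by move=> m; apply/measurable_EFinP; exact: measurable_funM.
- by move=> m w _; rewrite lee_fin mulr_ge0 ?exprn_ge0// prodr_ge0.
transitivity (\sum_(0 <= m <oo) ((\prod_(j | j != i) V l k j)%:E *
    (b i ^+ m * poisson_weight (lambda * fine (area (A i))) m)%:E))%E.
  apply: eq_eseriesr => m _.
  under eq_integral do rewrite EFinM.
  rewrite ge0_integralZl//; last 3 first.
  - exact/measurable_EFinP.
  - by move=> w _; rewrite lee_fin prodr_ge0.
  - by rewrite lee_fin exprn_ge0.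
  rewrite IH ?(ltnW ln)// VE -!EFinM; congr EFin; ring.
rewrite nneseriesZl; last first.
  move=> m _; rewrite lee_fin mulr_ge0 ?exprn_ge0//.
  rewrite /poisson_weight !mulr_ge0 ?expR_ge0 ?invr_ge0 ?ler0n//.
  by rewrite exprn_ge0// mulr_ge0 ?(ltW lambda0)// fine_ge0.
rewrite poisson_series -EFinM mulrC; congr EFin.
rewrite [RHS](bigD1 i)//= {2}/V ltnSn; congr (_ * _).
by apply: eq_bigr => j ji; rewrite /V neq_i.
Qed.
End poisson_process.

(** * The probability generating functional *)

Section poisson_functional.
Context (R : realType) (d : measure_display) (Omega : measurableType d)
  (P : probability Omega R) (lambda : R) (X : nat -> Omega -> R * R)
  (lambda0 : 0 < lambda) (PX : homogeneous_PPP P lambda X).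

Local Notation plane := (@lebesgue_measure R \x @lebesgue_measure R)%E.

Lemma cvg_expectation01 (f_ : nat -> Omega -> R) (f : Omega -> R) :
  (forall n, measurable_fun setT (f_ n)) -> (forall n w, 0 <= f_ n w <= 1) ->
  (forall w, f_ ^~ w @ \oo --> f w) ->
  ((\int[P]_w (f_ n w)%:E)%E @[n --> \oo] --> (\int[P]_w (f w)%:E)%E).
Proof.
move=> mf f01 ff.
apply: (@dominated_cvg _ _ _ P setT measurableT _ _ (EFin \o cst 1)) => //.
- by move=> n; exact/measurable_EFinP.
- by move=> w _; apply/cvg_EFin; [exact: nearW|exact: ff].
- exact: finite_measure_integrable_cst.
- by move=> n w _; case/andP: (f01 n w) => f0 f1; rewrite gee0_abs lee_fin.
Qed.

Lemma prod01 (J : nat) (h : 'I_J -> R) :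
  (forall i, 0 <= h i <= 1) -> 0 <= \prod_(i < J) h i <= 1.
Proof.
move=> h01; apply: (big_ind (fun x => 0 <= x <= 1)) => //.
  by rewrite ler01 lexx.
by move=> x y /andP[x0 x1] /andP[y0 y1]; rewrite mulr_ge0// mulr_ile1.
Qed.

Lemma measurable_prod_points (h : R * R -> R) (J : nat) :
  measurable_fun [set: (R * R)%type] h ->
  measurable_fun setT (fun w => \prod_(i < J) (1 - h (X i w))).
Proof.
move=> mh; apply: measurable_prod => i _; apply: measurable_funB => //.
by apply: (measurableT_comp mh); exact: PPP_measurable PX i.
Qed.

(** Exchanging the products over points and over sets turns the integrand into the product of the
    b_j^(partial count of A_j). It lies in [0, 1], so the limit in J passes under the
    expectation. *)
Lemma poisson_prod_cvg (n : nat) (A : 'I_n -> set (R * R)) (b : 'I_n -> R)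
    (h : R * R -> R) :
  (forall j, measurable (A j)) -> (forall j, (area (A j) < +oo)%E) ->
  trivIset setT A -> (forall j, 0 <= b j < 1) ->
  measurable_fun [set: (R * R)%type] h -> (forall y, 0 <= h y <= 1) ->
  (forall y, 1 - h y = \prod_j (1 - (1 - b j) * \1_(A j) y)) ->
  ((\int[P]_w (\prod_(i < J) (1 - h (X i w)))%:E)%E @[J --> \oo] -->
   (\prod_j expR (- (lambda * fine (area (A j)) * (1 - b j))))%:E).
Proof.
move=> mA Afin tA b01 mh h01 hE; rewrite -(poisson_pgf lambda0 PX)//.
apply: cvg_expectation01.
- by move=> J; exact: measurable_prod_points.
- move=> J w; apply: prod01 => i; have /andP[h0 h1] := h01 (X i w).
  by rewrite subr_ge0 h1 lerBlDr lerDl.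
move=> w.
rewrite (_ : (fun J => _) =
    (fun J => \prod_j (b j ^+ count_points X J (A j) w))); last first.
  apply/funext => J.
  transitivity (\prod_(i < J) \prod_j (1 - (1 - b j) * \1_(A j) (X i w))).
    by apply: eq_bigr => i _; exact: hE.
  by rewrite exchange_big/=; apply: eq_bigr => j _; rewrite expr_count_points.
apply: cvg_big => [|j _]; first exact: mul_continuous.
exact: (pow_countE X (A j) w (b01 j)).1.
Qed.

Lemma pgfl_simple
    (g : {nnsfun (measurableTypeR R * measurableTypeR R)%type >-> R}) :
  (forall y, g y <= 1) ->
  (area [set y | (0 < g y)%R] < +oo)%E ->
  (\int[plane]_y (g y)%:E < +oo)%E /\
  ((\int[P]_w (\prod_(i < J) (1 - g (X i w)))%:E)%E @[J --> \oo] -->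
    (expR (- (lambda * fine (\int[plane]_y (g y)%:E))))%:E).
Proof.
move=> g1 gfin; have g0 y : 0 <= g y by exact: fun_ge0.
have finV : finite_set (range g `&` [set r | 0 < r]).
  by apply: finite_setIl; exact: fimfunP.
(* The value 0 is left out: its level set may have infinite area, and its points contribute only
   factors 1. Positivity of the remaining values also gives b_j = 1 - s_j < 1. *)
pose s : seq R := finmap.enum_fset (fset_set (range g `&` [set r | 0 < r])).
have us : uniq s by exact: finmap.fset_uniq.
have sP r : (r \in s) = (r \in range g) && (0 < r).
  rewrite /s in_fset_set// in_setI; congr (_ && _).
  by apply/idP/idP; rewrite inE.
pose n := size s; pose A (j : 'I_n) : set (R * R) := g @^-1` [set s`_j].
have s0 (j : 'I_n) : 0 < s`_j.
  by have := mem_nth 0 (ltn_ord j); rewrite sP => /andP[].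
have s1 (j : 'I_n) : s`_j <= 1.
  have := mem_nth 0 (ltn_ord j); rewrite sP => /andP[+ _].
  by rewrite inE => -[y _ <-].
have mg : measurable_fun [set: (R * R)%type] g.
  have h : measurable_fun [set: (measurableTypeR R * measurableTypeR R)%type] g.
    exact: measurable_funP.
  exact: h.
have mA j : measurable (A j).
  by rewrite -[A j]setTI; exact: mg measurableT _ (measurable_set1 _).
have Afin j : (area (A j) < +oo)%E.
  apply: le_lt_trans gfin; apply: le_measure; rewrite ?inE; [exact: mA| |].
    rewrite (_ : [set y | 0 < g y] = setT `&` g @^-1` `]0, +oo[).
      exact: mg measurableT _ (measurable_itv _).
    by rewrite setTI; apply/seteqP; split => y /=; rewrite in_itv/= andbT.
  by move=> y /= ->.
have tA : trivIset setT A.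
  apply/trivIsetP => i j _ _ ij; rewrite -subset0 => y [/= yi yj].
  move/negP: ij; apply; rewrite -val_eqE/= -(nth_uniq 0 (ltn_ord i) (ltn_ord j) us).
  by apply/eqP; rewrite -yi -yj.
pose b (j : 'I_n) := 1 - s`_j.
have b01 j : 0 <= b j < 1 by rewrite subr_ge0 s1 ltrBlDr ltrDl s0.
have hE y : 1 - g y = \prod_j (1 - (1 - b j) * \1_(A j) y).
  have [gy|gy] := boolP (g y \in s).
    have gs : (index (g y) s < n)%N by rewrite index_mem.
    rewrite (bigD1 (Ordinal gs))//= big1 ?mulr1.
      rewrite /b subKr indicE mem_set ?mulr1 /A/= nth_index//.
    move=> j ij; rewrite indicE memNset ?mulr0 ?subr0// /A/= => gyj.
    by move/negP: ij; apply; rewrite -val_eqE/= gyj index_uniq.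
  have gy0 : g y = 0.
    apply/eqP; rewrite eq_le g0 andbT leNgt; apply: contra gy => gy0.
    by rewrite sP gy0 andbT inE; exists y.
  rewrite gy0 subr0 big1// => j _; rewrite indicE memNset ?mulr0 ?subr0//.
  by rewrite /A/= gy0 => s0j; have := s0 j; rewrite -s0j ltxx.
pose S : R := \sum_(j < n) s`_j * fine (area (A j)).
have intg : (\int[plane]_y (g y)%:E = S%:E)%E.
  transitivity (\sum_(x \in [set r | (0 < r)%R])
      (x%:E * area (g @^-1` [set x])))%E.
    by rewrite integralT_nnsfun sintegralEnnsfun.
  rewrite -(@fsbig_widen _ _ _ _ (range g `&` [set r | 0 < r]))//; last first.
    move=> r [/= r0 rg]; rewrite (_ : g @^-1` [set r] = set0).
      by rewrite (_ : area set0 = 0%E) ?mule0//; exact: measure0.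
    by apply/seteqP; split => y //= gy; apply: rg; split => //; exists y.
  rewrite fsbig_finite// -/s (big_nth 0) big_mkord -sumEFin.
  by apply: eq_bigr => j _; rewrite EFinM fineK// ge0_fin_numE.
rewrite intg; split; first by rewrite ltry.
have := poisson_prod_cvg mA Afin tA b01 mg _ hE.
rewrite (_ : (\prod_j _)%:E = (expR (- (lambda * fine S%:E)))%:E).
  by apply => y; rewrite g0 g1.
congr EFin; rewrite /= /S mulr_sumr -sumrN.
rewrite (big_morph _ (@expRD R) (@expR0 R)); apply: eq_bigr => j _.
by rewrite /b subKr; congr (expR (- _)); ring.
Qed.

End poisson_functional.

Section poisson_generating_functional.
Context (R : realType) (d : measure_display) (Omega : measurableType d)
  (P : probability Omega R) (lambda : R) (X : nat -> Omega -> R * R)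
  (lambda0 : 0 < lambda) (PX : homogeneous_PPP P lambda X).

Local Notation plane := (@lebesgue_measure R \x @lebesgue_measure R)%E.
Local Notation mplane := (measurableTypeR R * measurableTypeR R)%type.

Let expectation_prod (h : R * R -> R) (J : nat) : \bar R :=
  (\int[P]_w (\prod_(i < J) (1 - h (X i w)))%:E)%E.

Lemma expectation_prod_nd (h1 h2 : R * R -> R) (J K : nat) :
  measurable_fun [set: (R * R)%type] h1 ->
  measurable_fun [set: (R * R)%type] h2 ->
  (forall y, 0 <= h1 y <= h2 y) -> (forall y, h2 y <= 1) -> (J <= K)%N ->
  (expectation_prod h2 K <= expectation_prod h1 J)%E.
Proof.
move=> mh1 mh2 h12 h21 JK; apply: ge0_le_integral => //.
- move=> w _; rewrite lee_fin; apply: prodr_ge0 => i _.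
  by rewrite subr_ge0.
- by apply/measurable_EFinP; exact: (measurable_prod_points PX).
- by apply/measurable_EFinP; exact: (measurable_prod_points PX).
move=> w _; rewrite lee_fin -(subnKC JK) big_split_ord/=.
rewrite -[leRHS]mulr1; apply: ler_pM.
- by apply: prodr_ge0 => i _; rewrite subr_ge0.
- by apply: prodr_ge0 => i _; rewrite subr_ge0.
- apply: ler_prod => i _; rewrite subr_ge0 h21/= lerD2l lerN2.
  by case/andP: (h12 (X i w)).
- apply: prodr_ile1 => i _; rewrite subr_ge0 h21/= lerBlDr lerDl.
  by case/andP: (h12 (X (J + i)%N w)) => a b; exact: le_trans b.
Qed.

(** The limits in J and in the approximation g_n of [h] are exchanged by monotonicity, as the
    expected product decreases both in J and in the function. Comparison with g_n at J = oo bounds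
    the limit from above by exp (- lambda c_n) for every n. Conversely, at fixed J the product for
    [h] is the limit of those for g_n, each at least exp (- lambda c_n), hence at least exp (-
    lambda int h). The integral of [h] may be infinite; the limit is then 0. *)
Lemma poisson_pgfl (h : R * R -> R) :
  measurable_fun [set: (R * R)%type] h -> (forall y, 0 <= h y <= 1) ->
  ((\int[P]_w (\prod_(i < J) (1 - h (X i w)))%:E)%E @[J --> \oo] -->
    expeR (- (lambda%:E * \int[plane]_y (h y)%:E))%E).
Proof.
move=> mh h01.
have h0 y : 0 <= h y by case/andP: (h01 y).
have h1 y : h y <= 1 by case/andP: (h01 y).
have mh' : measurable_fun [set: mplane] (EFin \o h) by exact/measurable_EFinP.
(* The boxes give the approximations supports of finite area, as the simple case demands. *)
pose box n : set mplane := `[- n%:R, n%:R]%classic `*` `[- n%:R, n%:R]%classic.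
have mbox n : measurable (box n) by exact: measurableX.
pose g n := proj_nnsfun (nnsfun_approx measurableT mh' n) (mbox n).
have gE n y : g n y = nnsfun_approx measurableT mh' n y * \1_(box n) y by [].
have g0 n y : 0 <= g n y by exact: fun_ge0.
have gnd y : {homo g ^~ y : m n / (m <= n)%N >-> m <= n}.
  move=> m n mn; rewrite !gE; apply: ler_pM => //.
    exact/lefP/nd_nnsfun_approx.
  rewrite !indicE ler_nat; case: (boolP (y \in box m)) => //.
  rewrite inE /box => -[/=]; rewrite !in_itv/= => /andP[a1 a2] /andP[b1 b2].
  have mn' : m%:R <= n%:R :> R by rewrite ler_nat.
  by rewrite mem_set//; split; rewrite /= in_itv/=; apply/andP; split; lra.
have gh y : g ^~ y @ \oo --> h y.
  have ha : (nnsfun_approx measurableT mh' n y) @[n --> \oo] --> h y.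
    have h0' z : [set: mplane] z -> (0 <= (EFin \o h) z)%E.
      by move=> _; rewrite lee_fin.
    exact: (fine_cvg (cvg_nnsfun_approx measurableT mh' h0' (I : setT y))).
  rewrite -[h y]mulr1; under eq_fun do rewrite gE.
  apply: cvgM => //; apply: cvg_near_cst.
  exists (Num.truncn (`|y.1| + `|y.2|)).+1 => // n /= yn.
  have yn' : `|y.1| + `|y.2| < n%:R.
    by apply: lt_le_trans (truncnS_gt _) _; rewrite ler_nat.
  have := ler_norm y.1; have := ler_norm (- y.1).
  have := ler_norm y.2; have := ler_norm (- y.2); rewrite !normrN => a1 a2 b1 b2.
  have c1 := normr_ge0 y.1; have c2 := normr_ge0 y.2.
  by rewrite indicE mem_set//; split; rewrite /= in_itv/=; apply/andP; split; lra.
have gleh n y : g n y <= h y.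
  have := @nondecreasing_cvgn_le _ _ (gnd y) (cvgP _ (gh y)) n.
  by rewrite (cvg_lim _ (gh y)).
have g1 n y : g n y <= 1 by exact: le_trans (gleh n y) (h1 y).
have mg n : measurable_fun [set: (R * R)%type] (g n).
  have mgn : measurable_fun [set: mplane] (g n) by exact: measurable_funP.
  exact: mgn.
have boxfin n : (area (box n) < +oo)%E.
  rewrite /area /box product_measure1E//= !lebesgue_measure_itv/=.
  by case: ifPn => _; rewrite -?EFinB -?EFinM ?mul0e ltry.
have gfin n : (area [set y | (0 < g n y)%R] < +oo)%E.
  apply: le_lt_trans (boxfin n); apply: le_measure; rewrite ?inE.
  - rewrite (_ : [set y | 0 < g n y] = setT `&` g n @^-1` `]0, +oo[).
      exact: mg measurableT _ (measurable_itv _).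
    by rewrite setTI; apply/seteqP; split => y /=; rewrite in_itv/= andbT.
  - exact: mbox.
  - move=> y; rewrite /mkset gE indicE; case: (boolP (y \in box n)).
      by rewrite inE.
    by rewrite mulr0 ltxx.
have simple n := pgfl_simple lambda0 PX (g1 n) (gfin n).
pose c n := (\int[plane]_y (g n y)%:E)%E.
have cfin n : c n \is a fin_num.
  rewrite ge0_fin_numE; first exact: (simple n).1.
  by apply: integral_ge0 => y _; rewrite lee_fin.
have cc : c @ \oo --> (\int[plane]_y (h y)%:E)%E.
  rewrite (_ : (\int[plane]_y (h y)%:E)%E =
      (\int[plane]_y limn (fun n => (g n y)%:E))%E); last first.
    apply: eq_integral => y _; apply/esym/cvg_lim => //.
    by apply/cvg_EFin; [exact: nearW|exact: gh].
  apply: cvg_monotone_convergence => //.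
  - by move=> n; apply/measurable_EFinP; exact: measurable_funP.
  - by move=> n y _; rewrite lee_fin.
  - by move=> y _ m n mn; rewrite lee_fin; exact: gnd.
have simpleE n : expectation_prod (g n) @ \oo --> expeR (- (lambda%:E * c n))%E.
  have [_] := simple n; rewrite -/(c n).
  by rewrite -{2}(fineK (cfin n)) -EFinM -EFinN.
have nd1 (h' : R * R -> R) : measurable_fun [set: (R * R)%type] h' ->
    (forall y, 0 <= h' y <= 1) ->
    {homo expectation_prod h' : m n / (m <= n)%N >-> (n <= m)%E}.
  move=> mh1 h1' m n; apply: expectation_prod_nd => // y.
    by case/andP: (h1' y) => a b; rewrite a lexx.
  by case/andP: (h1' y).
have cu := ereal_nonincreasing_cvgn (nd1 h mh h01).
set l := ereal_inf _ in cu.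
have l0 : (0 <= l)%E.
  apply: le_ereal_inf_tmp => _ [J _ <-]; apply: integral_ge0 => w _.
  by rewrite lee_fin; apply: prodr_ge0 => i _; rewrite subr_ge0.
suff <- : l = expeR (- (lambda%:E * \int[plane]_y (h y)%:E))%E by [].
apply/eqP; rewrite eq_le; apply/andP; split.
  have ln n : (l <= expeR (- (lambda%:E * c n)))%E.
    rewrite -(cvg_lim _ cu)// -(cvg_lim _ (simpleE n))//.
    apply: lee_lim; [exact: cvgP cu|exact: cvgP (simpleE n)|].
    apply: nearW => J; apply: expectation_prod_nd => // y.
    by rewrite g0 gleh.
  (* Writing the limit as an exponential, with logarithm -oo when it is 0, moves the comparison to
     the exponents, where only the limit of lambda c_n has to be taken. *)
  have lE : l = expeR (lne l) by rewrite lneK// in_itv/= l0 leey.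
  rewrite lE lee_expeR leeNr.
  have clim : (lambda%:E * c n)%E @[n --> \oo] -->
      (lambda%:E * \int[plane]_y (h y)%:E)%E by exact: cvgeZl.
  rewrite -(cvg_lim _ clim)//; apply: lime_le; first exact: cvgP clim.
  by apply: nearW => n; rewrite leeNr -lee_expeR -lE; exact: ln.
apply: le_ereal_inf_tmp => _ [J _ <-].
have uJ : expectation_prod (g n) J @[n --> \oo] --> expectation_prod h J.
  apply: cvg_expectation01 => [n|n w|w].
  - exact: (measurable_prod_points PX).
  - by apply: prod01 => i; rewrite subr_ge0 g1 lerBlDr lerDl g0.
  - apply: cvg_big => [|i _]; first exact: mul_continuous.
    by apply: cvgB; [exact: cvg_cst|exact: gh].
rewrite -(cvg_lim _ uJ)//; apply: lime_ge; first exact: cvgP uJ.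
apply: nearW => n; apply: (@le_trans _ _ (expeR (- (lambda%:E * c n)))).
  rewrite lee_expeR leeN2 lee_pmul2l ?lte_fin//.
  apply: ge0_le_integral => //.
  - by move=> y _; rewrite lee_fin.
  - by apply/measurable_EFinP; exact: measurable_funP.
  - by move=> y _; rewrite lee_fin.
rewrite -(cvg_lim _ (simpleE n))//; apply: lime_le; first exact: cvgP (simpleE n).
have g01 (y : R * R) : 0 <= g n y <= 1.
  by apply/andP; split; [exact: g0|exact: g1].
by exists J => // K /= JK; exact: (nd1 _ (mg n) g01).
Qed.
End poisson_generating_functional.

(** * Blockages hitting links *)

(* Whether a segment with centre c, direction e = (e1, e2) and length l meets
   the link to y, by Cramer's rule applied to c + u e = v y.  When e and y are
   parallel the two segments are compared as intervals of the line. *)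
Definition hits (R : realType) (c1 c2 l e1 e2 y1 y2 : R) : bool :=
  let D := y1 * e2 - y2 * e1 in
  let k := y1 * e1 + y2 * e2 in
  let s := c1 * e1 + c2 * e2 in
  if D != 0 then
    [&& `|c1 * y2 - c2 * y1| <= l / 2 * `|D|, 0 <= (c1 * e2 - c2 * e1) * D &
        (c1 * e2 - c2 * e1) * D <= D ^+ 2]
  else [&& c1 * e2 - c2 * e1 == 0, 0 <= l &
    (if 0 <= k then (s - l / 2 <= k) && (0 <= s + l / 2)
     else (s - l / 2 <= 0) && (k <= s + l / 2))].

(** Eliminating the two existential parameters leaves a Boolean combination of comparisons between
    measurable expressions, from which measurability of the link types follows. *)
Lemma hits_spec (R : realType) (c1 c2 l e1 e2 y1 y2 : R) :
  e1 ^+ 2 + e2 ^+ 2 = 1 ->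
  (exists u v, [/\ `|u| <= l / 2, 0 <= v <= 1, c1 + u * e1 = v * y1 &
    c2 + u * e2 = v * y2]) <-> hits c1 c2 l e1 e2 y1 y2.
Proof.
move=> e12; rewrite /hits.
set D := y1 * e2 - y2 * e1; set k := y1 * e1 + y2 * e2.
set s := c1 * e1 + c2 * e2.
have [D0|D0] /= := eqVneq D 0; last first.
  split.
    move=> [u [v [ul /andP[v0 v1] h1 h2]]].
    have -> : c1 * y2 - c2 * y1 = u * D.
      have -> : c1 = v * y1 - u * e1 by rewrite -h1; ring.
      have -> : c2 = v * y2 - u * e2 by rewrite -h2; ring.
      by rewrite /D; ring.
    have -> : c1 * e2 - c2 * e1 = v * D.
      have -> : c1 = v * y1 - u * e1 by rewrite -h1; ring.
      have -> : c2 = v * y2 - u * e2 by rewrite -h2; ring.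
      by rewrite /D; ring.
    rewrite normrM ler_wpM2r//= -mulrA -expr2 mulr_ge0 ?sqr_ge0//=.
    by rewrite ler_piMl ?sqr_ge0.
  move=> /and3P[h1 h2 h3].
  have D2 : 0 < D ^+ 2 by rewrite exprn_even_gt0.
  exists ((c1 * y2 - c2 * y1) / D), ((c1 * e2 - c2 * e1) / D); split.
  - by rewrite normf_div ler_pdivrMr ?normr_gt0.
  - have -> : (c1 * e2 - c2 * e1) / D = (c1 * e2 - c2 * e1) * D / D ^+ 2.
      by field.
    by rewrite divr_ge0 ?(ltW D2)//= ler_pdivrMr// mul1r.
  - by rewrite /D in D0 *; field.
  - by rewrite /D in D0 *; field.
(* With D = 0 and a unit direction, y = k e. The centre will likewise be s e, which leaves the
   intervals [s - l/2, s + l/2] and [0, k] (or [k, 0]) to be compared. *)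
have y1E : y1 = k * e1.
  have -> : k * e1 = y1 * (e1 ^+ 2 + e2 ^+ 2) - e2 * D by rewrite /k /D; ring.
  by rewrite e12 D0; ring.
have y2E : y2 = k * e2.
  have -> : k * e2 = y2 * (e1 ^+ 2 + e2 ^+ 2) + e1 * D by rewrite /k /D; ring.
  by rewrite e12 D0; ring.
split.
  move=> [u [v [ul /andP[v0 v1] h1 h2]]].
  have l0 : 0 <= l by have := le_trans (normr_ge0 u) ul; rewrite pmulr_lge0.
  have -> : c1 * e2 - c2 * e1 = 0.
    have -> : c1 = v * y1 - u * e1 by rewrite -h1; ring.
    have -> : c2 = v * y2 - u * e2 by rewrite -h2; ring.
    by rewrite y1E y2E; ring.
  have sE : s = v * k - u.
    rewrite /s.
    have -> : c1 = v * y1 - u * e1 by rewrite -h1; ring.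
    have -> : c2 = v * y2 - u * e2 by rewrite -h2; ring.
    have -> : (v * y1 - u * e1) * e1 + (v * y2 - u * e2) * e2 =
      v * k - u * (e1 ^+ 2 + e2 ^+ 2) by rewrite /k; ring.
    by rewrite e12 mulr1.
  rewrite eqxx l0 sE /=; move: ul; rewrite ler_norml => /andP[u1 u2].
  by case: ifPn => [k0|]; [|rewrite -ltNge => k0]; apply/andP; split; nra.
move=> /and3P[/eqP ce l0 kk].
have c1E : c1 = s * e1.
  have -> : s * e1 = c1 * (e1 ^+ 2 + e2 ^+ 2) - e2 * (c1 * e2 - c2 * e1).
    by rewrite /s; ring.
  by rewrite e12 ce; ring.
have c2E : c2 = s * e2.
  have -> : s * e2 = c2 * (e1 ^+ 2 + e2 ^+ 2) + e1 * (c1 * e2 - c2 * e1).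
    by rewrite /s; ring.
  by rewrite e12 ce; ring.
(* Here [x] is the abscissa of a common point along the direction. If the end of the blockage nearer
   to the origin lies on the side of the link, it is the witness; otherwise the origin is. *)
suff [x [v [xs v01 vk]]] : exists x v, [/\ `|x - s| <= l / 2, 0 <= v <= 1 &
    v * k = x].
  exists (x - s), v; split => //.
  - by rewrite y1E mulrA vk {1}c1E; ring.
  - by rewrite y2E mulrA vk {1}c2E; ring.
case: (ltgtP 0 k) kk => [k0|k0|k0] /andP[a1 a2].
- have [s0|s0] := leP 0 (s - l / 2).
    exists (s - l / 2), ((s - l / 2) / k); split.
    + by rewrite ler_norml; apply/andP; split; lra.
    + by rewrite divr_ge0 ?(ltW k0)//= ler_pdivrMr// mul1r.
    + by rewrite divfK// gt_eqF.
  exists 0, 0; split; [|by rewrite lexx ler01|by rewrite mul0r].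
  by rewrite ler_norml; apply/andP; split; lra.
- have [s0|s0] := leP (s + l / 2) 0.
    exists (s + l / 2), ((s + l / 2) / k); split.
    + by rewrite ler_norml; apply/andP; split; lra.
    + by rewrite ler_ndivrMr// mul1r a2 andbT mulr_le0// invr_le0 ltW.
    + by rewrite divfK// lt_eqF.
  exists 0, 0; split; [|by rewrite lexx ler01|by rewrite mul0r].
  by rewrite ler_norml; apply/andP; split; lra.
- exists 0, 0; split; [|by rewrite lexx ler01|by rewrite mul0r].
  by rewrite ler_norml; apply/andP; split; lra.
Qed.

Lemma hitsP (R : realType) (c y : R * R) (l a : R) :
  blockage c l a `&` link y !=set0 <->
  hits c.1 c.2 l (cos a) (sin a) y.1 y.2.
Proof.
apply: iff_trans (hits_spec _ _ _ _ _ (cos2Dsin2 a)); split.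
  move=> [z [[u ul ->] [v v01 [h1 h2]]]].
  by exists u, v.
move=> [u [v [ul v01 h1 h2]]].
by exists (v * y.1, v * y.2); split; [exists u; rewrite //= h1 h2|exists v].
Qed.

Lemma measurable_hits d (T : measurableType d) (R : realType)
    (c1 c2 l e1 e2 y1 y2 : T -> R) :
  measurable_fun setT c1 -> measurable_fun setT c2 -> measurable_fun setT l ->
  measurable_fun setT e1 -> measurable_fun setT e2 ->
  measurable_fun setT y1 -> measurable_fun setT y2 ->
  measurable_fun setT
    (fun t => hits (c1 t) (c2 t) (l t) (e1 t) (e2 t) (y1 t) (y2 t)).
Proof.
move=> mc1 mc2 ml me1 me2 my1 my2; rewrite /hits.
have mM (f g : T -> R) : measurable_fun setT f -> measurable_fun setT g ->
  measurable_fun setT (fun t => f t * g t) by move=> ? ?; exact: measurable_funM.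
have mB (f g : T -> R) : measurable_fun setT f -> measurable_fun setT g ->
  measurable_fun setT (fun t => f t - g t) by move=> ? ?; exact: measurable_funB.
have mD (f g : T -> R) : measurable_fun setT f -> measurable_fun setT g ->
  measurable_fun setT (fun t => f t + g t) by move=> ? ?; exact: measurable_funD.
have mDet : measurable_fun setT (fun t => y1 t * e2 t - y2 t * e1 t) by auto.
have mk : measurable_fun setT (fun t => y1 t * e1 t + y2 t * e2 t) by auto.
have ms : measurable_fun setT (fun t => c1 t * e1 t + c2 t * e2 t) by auto.
have mce : measurable_fun setT (fun t => c1 t * e2 t - c2 t * e1 t) by auto.
have mcy : measurable_fun setT (fun t => c1 t * y2 t - c2 t * y1 t) by auto.
have ml2 : measurable_fun setT (fun t => l t / 2) by auto.
have mabs (f : T -> R) : measurable_fun setT f ->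
  measurable_fun setT (fun t => `|f t|) by move=> ?; exact: measurableT_comp.
apply: measurable_fun_ifT.
- by apply: measurable_neg; apply: measurable_fun_eqr.
- apply: measurable_and; first by apply: measurable_fun_ler; auto.
  apply: measurable_and; first by apply: measurable_fun_ler; auto.
  by apply: measurable_fun_ler; auto; apply: measurable_funX.
apply: measurable_and; first exact: measurable_fun_eqr.
apply: measurable_and; first exact: measurable_fun_ler.
apply: measurable_fun_ifT; first exact: measurable_fun_ler.
  by apply: measurable_and; apply: measurable_fun_ler; auto.
by apply: measurable_and; apply: measurable_fun_ler; auto.
Qed.

Section blockage_links.
Context (R : realType) (db : measure_display) (OmegaB : measurableType db)
  (PB : probability OmegaB R) (mu : R)
  (law : probability (measurableTypeR R) R)
  (C : nat -> OmegaB -> R * R) (Len Ori : nat -> OmegaB -> R)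
  (BM : boolean_model PB mu law C Len Ori).

(** Measurability is needed jointly in the sample point and the end of the link: the joint type
    probabilities are then measures of sections of a measurable set, hence measurable in the
    endpoints. *)
Lemma measurable_link_is d (T : measurableType d) (W : T -> OmegaB)
    (Y : T -> R * R) (s : link_type) :
  measurable_fun setT W -> measurable_fun setT Y ->
  measurable [set t | link_is C Len Ori s (Y t) (W t)].
Proof.
move=> mW mY.
have mhit i : measurable [set t | hits (C i (W t)).1 (C i (W t)).2 (Len i (W t))
    (cos (Ori i (W t))) (sin (Ori i (W t))) (Y t).1 (Y t).2].
  have mC : measurable_fun setT (fun t => C i (W t)).
    exact: measurableT_comp (PPP_measurable (boolean_centres BM) i) mW.
  have mO : measurable_fun setT (fun t => Ori i (W t)).
    exact: measurableT_comp (boolean_Ori_measurable BM i) mW.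
  rewrite -[X in measurable X]setTI.
  apply: (@measurable_hits _ T R (fun t => (C i (W t)).1)
    (fun t => (C i (W t)).2) (fun t => Len i (W t)) (fun t => cos (Ori i (W t)))
    (fun t => sin (Ori i (W t))) (fun t => (Y t).1) (fun t => (Y t).2)
    _ _ _ _ _ _ _ measurableT [set true]) => //.
  - exact: (measurableT_comp measurable_fst mC).
  - exact: (measurableT_comp measurable_snd mC).
  - exact: measurableT_comp (boolean_Len_measurable BM i) mW.
  - apply: measurableT_comp mO; apply: continuous_measurable_fun.
    exact: continuous_cos.
  - apply: measurableT_comp mO; apply: continuous_measurable_fun.
    exact: continuous_sin.
  - exact: (measurableT_comp measurable_fst mY).
  - exact: (measurableT_comp measurable_snd mY).
have mclear : measurable [set t | link_is C Len Ori LoS (Y t) (W t)].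
  rewrite (_ : [set t | _] = \bigcap_i ~` [set t |
    hits (C i (W t)).1 (C i (W t)).2 (Len i (W t))
      (cos (Ori i (W t))) (sin (Ori i (W t))) (Y t).1 (Y t).2]).
    by apply: bigcap_measurable => // i _; exact: measurableC.
  apply/seteqP; split => t /= H i.
    by move=> _ /hitsP/set0P; rewrite H eqxx.
  have := H i Logic.I; apply: contra_notP => /eqP/set0P.
  by move/hitsP.
case: s => //; rewrite (_ : [set t | _] =
  ~` [set t | link_is C Len Ori LoS (Y t) (W t)]) //.
exact: measurableC.
Qed.

Lemma measurable_link_is1 (s : link_type) (y : R * R) :
  measurable (link_is C Len Ori s y).
Proof. exact: (@measurable_link_is _ OmegaB id (cst y)). Qed.

Lemma measurable_p_joint d (T : measurableType d) (Y1 Y2 : T -> R * R)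
    (s v : link_type) :
  measurable_fun setT Y1 -> measurable_fun setT Y2 ->
  measurable_fun setT (fun t => p_joint PB C Len Ori s v (Y1 t) (Y2 t)).
Proof.
move=> mY1 mY2.
pose A : set (T * OmegaB) :=
  [set z | link_is C Len Ori s (Y1 z.1) z.2] `&`
  [set z | link_is C Len Ori v (Y2 z.1) z.2].
have mA : measurable A.
  by apply: measurableI; apply: measurable_link_is => //;
    exact: (measurableT_comp _ measurable_fst).
have -> : (fun t => p_joint PB C Len Ori s v (Y1 t) (Y2 t)) =
    (fun t => fine (PB (xsection A t))).
  by apply/funext => t; rewrite /p_joint; congr (fine (PB _));
    apply/seteqP; split => w; rewrite /xsection/= inE.
apply: measurableT_comp => //.
exact: measurable_fun_xsection.
Qed.

End blockage_links.

(** * The serving probability *)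

Lemma measurable_enorm (R : realType) :
  measurable_fun [set: (R * R)%type] (@enorm R).
Proof.
have msqrt : measurable_fun [set: R] (@Num.sqrt R).
  by apply: continuous_measurable_fun; exact: sqrt_continuous.
apply: (measurableT_comp msqrt); apply: measurable_funD.
  by apply: measurable_funX; exact: measurable_fst.
by apply: measurable_funX; exact: measurable_snd.
Qed.

Lemma indic_forall (R : realType) (T : Type) (I : finType) (A : I -> set T)
    (w : T) :
  \1_[set w | forall j, A j w] w = \prod_j \1_(A j) w :> R.
Proof.
rewrite indicE; case: (boolP (w \in _)) => [|/negP]; rewrite inE => Aw.
  by rewrite big1// => j _; rewrite indicE mem_set//; exact: Aw.
apply/esym/eqP/prodf_eq0; have /existsNP[j Ajw] : ~ forall j, A j w by [].
by exists j => //; rewrite indicE memNset.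
Qed.

(** Coding types by booleans makes the assignments of types to J points a finite type, over which
    the expansion of the void event is summed. *)
Definition bool_link (b : bool) : link_type := if b then LoS else NLoS.

Section marked_process.
Context (R : realType) (d : measure_display) (Omega : measurableType d)
  (P : probability Omega R) (lambda : R) (X : nat -> Omega -> R * R)
  (M : nat -> Omega -> link_type) (q : link_type -> R * R -> R)
  (lambda0 : 0 < lambda) (PX : homogeneous_PPP P lambda X)
  (TM : independent_types P X M q)
  (mq : forall v, measurable_fun [set: (R * R)%type] (q v))
  (q0 : forall v y, 0 <= q v y).

Local Notation plane := (@lebesgue_measure R \x @lebesgue_measure R)%E.

(** The point of index 0 has exactly one type, so 1 is the expectation of the sum of its two type
    probabilities, which is constantly c. *)
Lemma type_probabilities_sum (c : R) : (forall y, q LoS y + q NLoS y = c) ->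
  c = 1.
Proof.
move=> qc.
have mqX v : measurable_fun setT (fun w => (q v (X 0 w))%:E).
  by apply/measurable_EFinP; exact: measurableT_comp (mq v) (PPP_measurable PX 0).
have PE v : (P [set w | M 0 w = v] = \int[P]_w (q v (X 0 w))%:E)%E.
  have sT : sigma_points X setT.
    exact: (@measurableT _ (g_sigma_algebraType
      [set E | exists i (B : set (R * R)), measurable B /\ E = X i @^-1` B])).
  have := types_law TM (fun _ : 'I_1 => v) sT.
  under eq_integral do rewrite big_ord1.
  move=> <-; congr (P _); apply/seteqP; split => w /=.
    by move=> Mv; split => // j; rewrite (ord1 j).
  by move=> [_ /(_ ord0)].
have : (P [set w | M 0 w = LoS] + P [set w | M 0 w = NLoS] = 1)%E.
  have mT v : measurable [set w | M 0 w = v] by exact: types_measurable TM _ _.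
  rewrite -measureU//; last by rewrite -subset0 => w [/= ->].
  rewrite -(probability_setT P); congr (P _); apply/seteqP; split => w //= _.
  by case: (M 0 w); [left|right].
rewrite !PE -ge0_integralD//; last 2 first.
- by move=> w _; rewrite lee_fin.
- by move=> w _; rewrite lee_fin.
under eq_integral do rewrite -EFinD qc.
by rewrite integral_cst// [X in (_ * X)%E]probability_setT mule1 => -[].
Qed.

Lemma marked_poisson_void (e : link_type -> \bar R) :
  (forall y, q LoS y + q NLoS y = 1) ->
  let h v y := q v y * \1_[set y | ((enorm y)%:E <= e v)%E] y in
  (P [set w | forall i v, M i w = v -> (e v < (enorm (X i w))%:E)%E] =
   expeR (- (lambda%:E * \int[plane]_y (h LoS y + h NLoS y)%:E)))%E.
Proof.
move=> q1 h.
pose K v := [set y : R * R | (e v < (enorm y)%:E)%E].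
have menorm : measurable_fun [set: (R * R)%type] (fun y => (enorm y)%:E).
  by apply/measurable_EFinP; exact: measurable_enorm.
have mK v : measurable (K v).
  rewrite -[K v]setTI; exact: emeasurable_fun_o_infty.
have KC v : [set y : R * R | ((enorm y)%:E <= e v)%E] = ~` K v.
  by apply/seteqP; split => y /=; rewrite leNgt => /negP.
have mX i : measurable_fun setT (X i) by exact: PPP_measurable PX i.
have hK v y : h v y = q v y * (1 - \1_(K v) y).
  rewrite /h KC !indicE in_setC; case: (y \in K v) => /=; ring.
pose V J := [set w | forall i, (i < J)%N -> K (M i w) (X i w)].
have mV1 i : measurable [set w | K (M i w) (X i w)].
  rewrite (_ : [set w | _] =
    ([set w | M i w = LoS] `&` (X i @^-1` K LoS)) `|`
    ([set w | M i w = NLoS] `&` (X i @^-1` K NLoS))).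
    apply: measurableU; apply: measurableI; try exact: (types_measurable TM);
      by rewrite -[X in measurable X]setTI; exact: mX.
  apply/seteqP; split => w /=; last by case=> -[->].
  by case: (M i w) => Kw; [left|right].
have mV J : measurable (V J).
  rewrite (_ : V J = \bigcap_(i in `I_J) [set w | K (M i w) (X i w)]).
    by apply: fin_bigcap_measurable => // i _; exact: mV1.
  by apply/seteqP; split => w Vw i /=; exact: Vw.
have VE : [set w | forall i v, M i w = v -> (e v < (enorm (X i w))%:E)%E] =
    \bigcap_J V J.
  apply/seteqP; split => w /= Vw.
    by move=> J _ i _; exact: Vw.
  by move=> i v <-; exact: (Vw i.+1 Logic.I i (ltnSn i)).
have PV : P (V J) @[J --> \oo] --> P (\bigcap_J V J).
  apply: nonincreasing_cvg_mu => //.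
  - by rewrite (le_lt_trans (probability_le1 P (mV 0%N)))// ltry.
  - exact: bigcap_measurable.
  - move=> m n mn; apply/subsetPset => w Vw i im.
    by apply: Vw; exact: leq_trans im mn.
rewrite VE; apply: (cvg_unique _ PV) => //.
pose hh y := h LoS y + h NLoS y.
have mhh : measurable_fun [set: (R * R)%type] hh.
  rewrite (_ : hh = fun y => q LoS y * (1 - \1_(K LoS) y) +
    q NLoS y * (1 - \1_(K NLoS) y)); last by apply/funext => y; rewrite /hh !hK.
  by apply: measurable_funD; apply: measurable_funM => //;
    apply: measurable_funB => //; exact: measurable_indic.
(* The upper bound holds because the two type probabilities sum to 1. *)
have hh01 y : 0 <= hh y <= 1.
  rewrite /hh !hK; have := q1 y; have := q0 LoS y; have := q0 NLoS y.
  rewrite !indicE; case: (y \in _); case: (y \in _) => /=; move=> a b c;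
    apply/andP; split; lra.
have := poisson_pgfl lambda0 PX mhh hh01.
rewrite (_ : (fun J => \int[P]_w _)%E = (fun J => P (V J))) //.
apply/funext => J.
pose m (j : 'I_J) (b : bool) w : R := \1_[set w | M j w = bool_link b] w.
(* For a fixed assignment the distance constraints involve the points only, so this event lies in
   [sigma_points] and the law of the types applies to it. *)
pose F (f : {ffun 'I_J -> bool}) :=
  [set w | forall j : 'I_J, K (bool_link (f j)) (X j w)].
have mF f : measurable (F f).
  rewrite (_ : F f = \bigcap_(j in [set: 'I_J]) (X j @^-1` K (bool_link (f j)))).
    apply: fin_bigcap_measurable => // j _.
    by rewrite -[X in measurable X]setTI; exact: mX.
  by apply/seteqP; split => w Fw j; [move=> _; exact: Fw|exact: (Fw j Logic.I)].
have sF f : sigma_points X (F f).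
  rewrite (_ : F f = \bigcap_(j in [set: 'I_J]) (X j @^-1` K (bool_link (f j)))).
    apply: (@fin_bigcap_measurable _ (g_sigma_algebraType [set E |
      exists i (B : set (R * R)), measurable B /\ E = X i @^-1` B])) => // j _.
    by apply: sub_sigma_algebra; exists j, (K (bool_link (f j))).
  by apply/seteqP; split => w Fw j; [move=> _; exact: Fw|exact: (Fw j Logic.I)].
pose E (f : {ffun 'I_J -> bool}) :=
  F f `&` [set w | forall j : 'I_J, M j w = bool_link (f j)].
have mE f : measurable (E f).
  apply: measurableI => //.
  rewrite (_ : [set w | _] = \bigcap_(j in [set: 'I_J])
    [set w | M j w = bool_link (f j)]).
    by apply: fin_bigcap_measurable => // j _; exact: (types_measurable TM).
  by apply/seteqP; split => w Fw j; [move=> _; exact: Fw|exact: (Fw j Logic.I)].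
pose k (b : bool) w (j : 'I_J) : R := \1_(K (bool_link b)) (X j w).
have indF (f : {ffun 'I_J -> bool}) w : \1_(F f) w =
    \prod_j k (f j) w j :> R.
  rewrite /F (indic_forall R (fun j : 'I_J => X j @^-1` K (bool_link (f j)))).
  by apply: eq_bigr => j _; rewrite /k !indicE.
have indE (f : {ffun 'I_J -> bool}) w : \1_(E f) w =
    \prod_j (m j (f j) w * k (f j) w j) :> R.
  rewrite /E indicI/= indF mulrC big_split/=; congr (_ * _).
  exact: (indic_forall R (fun j : 'I_J => [set w | M j w = bool_link (f j)])).
(* In each factor exactly one of the two terms survives, the one of the actual type of the point. *)
have indV w : \1_(V J) w = \prod_(j < J) \sum_(b : bool) (m j b w * k b w j) :> R.
  rewrite (_ : V J = [set w | forall j : 'I_J, K (M j w) (X j w)]); last first.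
    by apply/seteqP; split => w' Vw; [move=> j; exact: Vw|move=> i iJ;
      exact: (Vw (Ordinal iJ))].
  rewrite (indic_forall R (fun j : 'I_J => [set w | K (M j w) (X j w)])).
  apply: eq_bigr => j _; rewrite big_bool/= /m /k !indicE.
  have lE (b : bool) : (w \in [set w | M j w = bool_link b]) =
      `[< M j w = bool_link b >] by apply/idP/asboolP; rewrite inE.
  rewrite !lE; case Mw : (M j w).
    rewrite asboolT//= (asboolF (P := LoS = NLoS))//= mul1r mul0r addr0.
    by congr (nat_of_bool _)%:R; apply/idP/idP; rewrite !inE/= Mw.
  rewrite (asboolT (P := NLoS = NLoS))//= asboolF//= mul1r mul0r add0r.
  by congr (nat_of_bool _)%:R; apply/idP/idP; rewrite !inE/= Mw.
have PE f : P (E f) = (\int[P]_w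
    (\prod_j (q (bool_link (f j)) (X j w) * k (f j) w j))%:E)%E.
  rewrite /E (types_law TM (fun j => bool_link (f j)) (sF f)).
  rewrite integral_mkcond; apply: eq_integral => w _.
  rewrite big_split/= -indF patchE indicE.
  by case: (w \in F f); rewrite ?mulr1 ?mulr0.
have mk b j : measurable_fun setT (fun w => k b w j).
  by apply: (measurableT_comp _ (mX j)); exact: measurable_indic.
transitivity (\sum_(f : {ffun 'I_J -> bool}) P (E f))%E; last first.
  rewrite -[P (V J)](_ : \int[P]_w (\1_(V J) w)%:E = _)%E; last first.
    by rewrite integral_indic// setIT.
  under eq_bigr do rewrite -[X in P X]setIT -integral_indic//.
  rewrite -ge0_integral_sum//.
    apply: eq_integral => w _; rewrite indV bigA_distr_bigA/= -sumEFin.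
    by apply: eq_bigr => f _; rewrite indE.
  by move=> f; apply/measurable_EFinP; exact: measurable_indic.
under [RHS]eq_bigr do rewrite PE.
rewrite -ge0_integral_sum//.
- apply: eq_integral => w _; rewrite sumEFin; congr EFin.
  rewrite -(bigA_distr_bigA (fun (j : 'I_J) (b : bool) =>
    q (bool_link b) (X j w) * k b w j)).
  apply: eq_bigr => j _; rewrite big_bool/= /hh !hK /k/=.
  by rewrite -{1}(q1 (X j w)); ring.
- move=> f; apply/measurable_EFinP; apply: measurable_prod => j _.
  by apply: measurable_funM => //; exact: measurableT_comp (mq _) (mX j).
- move=> f w _; rewrite lee_fin; apply: prodr_ge0 => j _.
  by rewrite mulr_ge0// /k indicE.
Qed.

End marked_process.

Lemma ge0_disc_integral (R : realType) (H : R * R -> R) (e : \bar R) :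
  measurable_fun [set: (R * R)%type] H -> (forall y, 0 <= H y) ->
  (\int[@lebesgue_measure R \x @lebesgue_measure R]_y
     (H y * \1_[set y | ((enorm y)%:E <= e)%E] y)%:E)%E =
  disc_integral (fun t a => H (polar t a)) e.
Proof.
move=> mH H0.
have menorm : measurable_fun [set: (R * R)%type] (fun y => (enorm y)%:E).
  by apply/measurable_EFinP; exact: measurable_enorm.
have mD : measurable ([set y | ((enorm y)%:E <= e)%E] : set (R * R)).
  by rewrite -[X in measurable X]setTI; exact: emeasurable_fun_infty_c.
have mI : measurable_fun [set: (R * R)%type] (fun y =>
    (H y * \1_[set y | ((enorm y)%:E <= e)%E] y)%:E).
  by apply/measurable_EFinP/measurable_funM => //; exact: measurable_indic.
rewrite ge0_integral_polar//; last first.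
  by move=> y; rewrite lee_fin mulr_ge0// indicE.
rewrite /disc_integral; apply: eq_integral => a _.
rewrite integral_mkcond [RHS]integral_mkcond; apply: eq_integral => t _.
rewrite !patchE mem_setE in_itv/= andbT.
have [t0|t0] := ltP 0 t.
  rewrite indicE.
  have -> : (polar t a \in [set y : R * R | ((enorm y)%:E <= e)%E]) = (t%:E <= e)%E.
    apply/idP/idP; rewrite inE/= /enorm/= !exprMn -mulrDr cos2Dsin2 mulr1;
      by rewrite sqrtr_sqr gtr0_norm.
  have -> : (t \in [set t1 : R | 0 <= t1 /\ (t1%:E <= e)%E]) = (t%:E <= e)%E.
    by apply/idP/idP; rewrite inE/=; [case|move=> te; split => //; exact: ltW].
  by case: (_ <= _)%E; rewrite ?mulr1 ?mulr0 -?EFinM ?mul0r.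
(* The domain of [disc_integral] contains t = 0, unlike that of the polar formula; the Jacobian t
   vanishes there. *)
case: ifPn => //; rewrite inE/= => -[t0' _].
by rewrite (_ : t = 0) ?mulr0//; apply/eqP; rewrite eq_le t0 t0'.
Qed.

(** * The serving density as a void probability *)

Definition serving_density (R : realType) (lambda : R)
    (ell : link_type -> R -> R) (p : link_type -> R -> R)
    (pp : link_type -> link_type -> R -> R -> R -> R) (s : link_type) :=
  match s with LoS => gL lambda ell p pp | NLoS => gN lambda ell p pp end.

Section first_order.
Context (R : realType) (lambda mu : R)
  (law : probability (measurableTypeR R) R)
  (db : measure_display) (OmegaB : measurableType db)
  (PB : probability OmegaB R)
  (C : nat -> OmegaB -> R * R) (Len Ori : nat -> OmegaB -> R)
  (ell : link_type -> R -> R)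
  (lambda0 : 0 < lambda) (mu0 : 0 < mu) (mean0 : (0 < mean law < +oo)%E)
  (BM : boolean_model PB mu law C Len Ori).

Local Notation plane := (@lebesgue_measure R \x @lebesgue_measure R)%E.
Local Notation beta := (blockage_rate mu law).
Local Notation p_joint := (p_joint PB C Len Ori).
Local Notation density :=
  (serving_density lambda ell (p1 beta) (p2 PB C Len Ori)).

(** Given that the station at distance x has type s, this is the probability that a station at y has
    type v and prevents it from serving. *)
Definition exclusion_rate (s v : link_type) (x : R) (y : R * R) : R :=
  p_joint s v (polar x 0) y / p1 beta s x *
  \1_[set y | ((enorm y)%:E <= excl ell v s x)%E] y.

Lemma blockage_rate_gt0 : 0 < beta.
Proof.
rewrite /blockage_rate divr_gt0 ?pi_gt0// !mulr_gt0//.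
exact: fine_gt0.
Qed.

Lemma p1_ge0 (s : link_type) (x : R) : 0 <= x -> 0 <= p1 beta s x.
Proof.
move=> x0; case: s => /=; first exact: expR_ge0.
by rewrite subr_ge0 expR_le1 oppr_le0 mulr_ge0// ltW// blockage_rate_gt0.
Qed.

Lemma p1_gt0 (s : link_type) (x : R) : 0 < x -> 0 < p1 beta s x.
Proof.
move=> x0; case: s => /=; first exact: expR_gt0.
by rewrite subr_gt0 expR_lt1 oppr_lt0 mulr_gt0// blockage_rate_gt0.
Qed.

Lemma p_joint_ge0 (s v : link_type) (y1 y2 : R * R) : 0 <= p_joint s v y1 y2.
Proof. by rewrite fine_ge0. Qed.

Lemma p_joint_sum (s : link_type) (y1 y2 : R * R) :
  p_joint s LoS y1 y2 + p_joint s NLoS y1 y2 = fine (PB (link_is C Len Ori s y1)).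
Proof.
have mI v : measurable (link_is C Len Ori s y1 `&` link_is C Len Ori v y2).
  by apply: measurableI; exact: measurable_link_is1 BM _ _.
rewrite -fineD; [|exact: fin_num_measure|exact: fin_num_measure].
rewrite -measureU//; last first.
  by rewrite -subset0 => w [[_ h1] [_]].
by rewrite -setIUr setUv setIT.
Qed.

Lemma measurable_p_joint1 (s v : link_type) (y1 : R * R) :
  measurable_fun [set: (R * R)%type] (fun y => p_joint s v y1 y).
Proof. exact: (measurable_p_joint BM). Qed.

Lemma integral_exclusion_rate (s v : link_type) (x : R) : 0 <= x ->
  (\int[plane]_y (exclusion_rate s v x y)%:E)%E =
  disc_integral (fun t a => p2 PB C Len Ori s v x t a / p1 beta s x)
    (excl ell v s x).
Proof.
move=> x0; apply: (@ge0_disc_integral _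
  (fun y => p_joint s v (polar x 0) y / p1 beta s x)).
  by apply: measurable_funM => //; exact: measurable_p_joint1.
by move=> y; rewrite divr_ge0 ?p_joint_ge0// p1_ge0.
Qed.

Lemma measurable_exclusion_rate (s v : link_type) (x : R) :
  measurable_fun [set: (R * R)%type] (exclusion_rate s v x).
Proof.
apply: measurable_funM.
  by apply: measurable_funM => //; exact: measurable_p_joint1.
apply: measurable_indic.
have menorm : measurable_fun [set: (R * R)%type] (fun y => (enorm y)%:E).
  by apply/measurable_EFinP; exact: measurable_enorm.
by rewrite -[X in measurable X]setTI; exact: emeasurable_fun_infty_c.
Qed.

Lemma exclusion_rate_ge0 (s v : link_type) (x : R) (y : R * R) : 0 <= x ->
  0 <= exclusion_rate s v x y.
Proof.
move=> x0; rewrite /exclusion_rate indicE mulr_ge0//.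
by rewrite divr_ge0 ?p_joint_ge0// p1_ge0.
Qed.

(** Both integrals are nonnegative, so they merge into one even when infinite; this brings [gL] and
    [gN] to the common form of a void probability. *)
Lemma serving_densityE (s : link_type) (x : R) : 0 <= x ->
  density s x = p1 beta s x * fine (expeR (- (lambda%:E *
    \int[plane]_y (exclusion_rate s LoS x y + exclusion_rate s NLoS x y)%:E))%E).
Proof.
move=> x0; under eq_integral do rewrite EFinD.
rewrite ge0_integralD//; last 4 first.
- by move=> y _; rewrite lee_fin exclusion_rate_ge0.
- by apply/measurable_EFinP; exact: measurable_exclusion_rate.
- by move=> y _; rewrite lee_fin exclusion_rate_ge0.
- by apply/measurable_EFinP; exact: measurable_exclusion_rate.
have I0 v : (0 <= \int[plane]_y (exclusion_rate s v x y)%:E)%E.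
  by apply: integral_ge0 => y _; rewrite lee_fin exclusion_rate_ge0.
rewrite ge0_muleDr// oppeD; last first.
  by apply: ge0_adde_def; rewrite inE mule_ge0// lee_fin ltW.
rewrite !integral_exclusion_rate//.
by case: s {I0}.
Qed.

Section law_at.
Context (d : measure_display) (Omega : measurableType d)
  (Q : probability Omega R) (T0 : Omega -> link_type)
  (X : nat -> Omega -> R * R) (M : nat -> Omega -> link_type) (x : R)
  (x0 : 0 < x)
  (FO : first_order_law PB C Len Ori beta Q lambda x T0 X M).

Let q (s v : link_type) (y : R * R) : R :=
  p_joint s v (polar x 0) y / p1 beta s x.

Let mq (s v : link_type) : measurable_fun [set: (R * R)%type] (q s v).
Proof. by apply: measurable_funM => //; exact: measurable_p_joint1. Qed.

Let q0 (s v : link_type) (y : R * R) : 0 <= q s v y.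
Proof. by rewrite divr_ge0 ?p_joint_ge0// p1_ge0// ltW. Qed.

(* The types of the first base station sum to one, which determines the law of
   a single link without computing it from the Boolean model. *)
Lemma link_is_prob (s : link_type) :
  fine (PB (link_is C Len Ori s (polar x 0))) = p1 beta s x.
Proof.
have p0 := p1_gt0 s x0.
set c := fine _; suff : c / p1 beta s x = 1.
  by move=> cp; rewrite -[c](divfK (lt0r_neq0 p0)) cp mul1r.
apply: (type_probabilities_sum (others_PPP FO s) (others_types FO s) (mq s) (q0 s)).
by move=> y; rewrite /q -mulrDl p_joint_sum.
Qed.

Lemma serving_prob (s : link_type) :
  Q (serving ell T0 X M s x) = (density s x)%:E.
Proof.
have p0 := p1_gt0 s x0.
have q1 y : q s LoS y + q s NLoS y = 1.
  by rewrite /q -mulrDl p_joint_sum link_is_prob divff// gt_eqF.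
rewrite serving_densityE; last exact: ltW.
set V := [set w | forall i v, M i w = v ->
  (excl ell v s x < (enorm (X i w))%:E)%E].
set I := expeR _.
have VE : cond_law Q (given_measurable FO s) V = I.
  exact: (marked_poisson_void lambda0 (others_PPP FO s) (others_types FO s)
    (mq s) (q0 s) (fun v => excl ell v s x) q1).
(* The exponential is at most 1, so [fine] loses nothing. *)
have Ifin : I \is a fin_num.
  rewrite ge0_fin_numE ?expeR_ge0// (@le_lt_trans _ _ 1%E) ?ltry//.
  rewrite -expeR0 lee_expeR oppe_le0 mule_ge0 ?lee_fin ?(ltW lambda0)//.
  apply: integral_ge0 => y _; rewrite lee_fin addr_ge0//;
    by apply: exclusion_rate_ge0; exact: ltW.
rewrite EFinM fineK// -VE /cond_law /mnormalize.
set D := [set w | T0 w = s].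
(* Unfolding [mnormalize] exposes its fallback for zero or infinite mass. The mass is p_s(x) > 0
   because x > 0, and it cancels against the factor in front. *)
change (Q (serving ell T0 X M s x) = (p1 beta s x)%:E *
  (if (Q (setT `&` D) == 0) || (Q (setT `&` D) == +oo) then fun U => Q U
   else fun U => Q (U `&` D) * ((fine (Q (setT `&` D)))^-1)%:E) V)%E.
rewrite setTI /D (given_prob FO s) eqe gt_eqF//= muleCA -EFinM divff ?gt_eqF// mule1.
congr (Q _).
by apply/seteqP; split => w [].
Qed.

End law_at.
End first_order.

(** * Measurability of the serving density in the distance *)

Lemma measurable_expeR (R : realType) :
  measurable_fun [set: \bar R] (@expeR R).
Proof.
apply: (measurability _ (ErealGenOInfty.measurableE R)) => //.
move=> _ [_ [r ->] <-]; rewrite setTI.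
have [r0|r0] := ltP r 0.
  rewrite (_ : _ @^-1` _ = setT)//; apply/seteqP; split => z //= _.
  by rewrite in_itv/= andbT (lt_le_trans _ (expeR_ge0 z))// lte_fin.
rewrite (_ : _ @^-1` _ = `]lne r%:E, +oo[%classic).
  exact: emeasurable_itv.
have rE z : (r%:E < expeR z)%E = (lne r%:E < z)%E.
  by rewrite -(lte_expeR (lne _)) lneK// in_itv/= lee_fin r0 leey.
by apply/seteqP; split => z /=; rewrite !in_itv/= !andbT rE.
Qed.

(** By monotonicity the preimage of a ray within [0, +oo[ is an interval. The absolute value makes a
    function that is controlled on [0, +oo[ only measurable on the whole line. *)
Lemma measurable_nd_normr (R : realType) (f : R -> \bar R) :
  (forall x y, 0 <= x -> x <= y -> (f x <= f y)%E) ->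
  measurable_fun [set: R] (fun x => f `|x|).
Proof.
move=> fnd; apply: (measurability _ (ErealGenOInfty.measurableE R)) => //.
move=> _ [_ [r ->] <-].
have -> : (fun x : R => f `|x|) @^-1` `]r%:E, +oo[ =
    Num.norm @^-1` [set x | 0 <= x /\ (r%:E < f x)%E].
  apply/seteqP; split => x /=; rewrite in_itv/= andbT ?normr_ge0//.
  by case.
have mN := @normr_measurable R setT.
apply: mN => //; apply: is_interval_measurable.
move=> x y /= [x0 fx] [y0 fy] z /andP[xz zy]; split; first exact: le_trans xz.
exact: lt_le_trans fx (fnd _ _ x0 xz).
Qed.

Section density_measurability.
Context (R : realType) (lambda mu : R)
  (law : probability (measurableTypeR R) R)
  (db : measure_display) (OmegaB : measurableType db)
  (PB : probability OmegaB R)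
  (C : nat -> OmegaB -> R * R) (Len Ori : nat -> OmegaB -> R)
  (ell : link_type -> R -> R)
  (lambda0 : 0 < lambda) (mu0 : 0 < mu) (mean0 : (0 < mean law < +oo)%E)
  (BM : boolean_model PB mu law C Len Ori) (PL : path_loss ell).

Local Notation plane := (@lebesgue_measure R \x @lebesgue_measure R)%E.
Local Notation mplane := (measurableTypeR R * measurableTypeR R)%type.
Local Notation beta := (blockage_rate mu law).
Local Notation p_joint := (p_joint PB C Len Ori).
Local Notation rate := (exclusion_rate mu law PB C Len Ori ell).
Local Notation density :=
  (serving_density lambda ell (p1 beta) (p2 PB C Len Ori)).

(** As x grows, the path loss at x decreases, the set of admissible y shrinks, and its infimum
    increases. *)
Lemma measurable_excl (s v : link_type) :
  measurable_fun [set: R] (fun x => excl ell v s `|x|).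
Proof.
apply: measurable_nd_normr => x y x0 xy; rewrite /excl.
case: v; case: s; rewrite ?lee_fin//.
- apply: ereal_inf_le_tmp; apply: image_subset => z /= [z0 h]; split => //.
  exact: le_trans h (path_loss_nonincreasing PL _ x0 xy).
- apply: ereal_inf_le_tmp; apply: image_subset => z /= [z0 h]; split => //.
  exact: le_trans h (path_loss_nonincreasing PL _ x0 xy).
Qed.

Lemma measurable_p1 (s : link_type) : measurable_fun [set: R] (p1 beta s).
Proof.
have mL : measurable_fun [set: R] (fun x => expR (- (beta * x))).
  apply: measurableT_comp => //; apply: measurable_funN.
  exact: measurable_funM.
by case: s => //=; exact: measurable_funB.
Qed.

Lemma measurable_exclusion_rate2 (s v : link_type) :
  measurable_fun [set: (R * (R * R))%type]
    (fun z : R * (R * R) => rate s v `|z.1| z.2).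
Proof.
have mfst : measurable_fun [set: (R * (R * R))%type]
    (fun z : R * (R * R) => z.1) by exact: measurable_fst.
have msnd : measurable_fun [set: (R * (R * R))%type]
    (fun z : R * (R * R) => z.2) by exact: measurable_snd.
have mN : measurable_fun [set: (R * (R * R))%type]
    (fun z : R * (R * R) => `|z.1|) by exact: measurableT_comp.
apply: measurable_funM.
  apply: measurable_funM.
    apply: (measurable_p_joint BM) => //.
    have mN0 : measurable_fun [set: (R * (R * R))%type]
      (fun z : R * (R * R) => (`|z.1|, 0 : R)) by exact: measurable_fun_pair.
    exact: (measurableT_comp (@measurable_polar R) mN0).
  apply: (measurableT_comp (@measurable_invr R)).
  exact: (measurableT_comp (measurable_p1 s)).
rewrite (_ : (fun z : R * (R * R) => _) = \1_[set z : R * (R * R) |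
    ((enorm z.2)%:E <= excl ell v s `|z.1|)%E]); last first.
  by apply/funext => z; rewrite !indicE; congr (nat_of_bool _)%:R;
    apply/idP/idP; rewrite !inE.
apply: measurable_indic; rewrite -[X in measurable X]setTI.
apply: measurable_lee => //.
  by apply/measurable_EFinP; exact: (measurableT_comp (@measurable_enorm R)).
exact: (measurableT_comp (measurable_excl s v)).
Qed.

Lemma measurable_density (s : link_type) :
  measurable_fun (`[0, +oo[ : set R) (density s).
Proof.
(* With the absolute value the rates are nonnegative for every real x, so measurability of the
   integral in x follows from Tonelli. *)
pose I (x : R) := (\int[plane]_y (rate s LoS `|x| y + rate s NLoS `|x| y)%:E)%E.
have mI : measurable_fun [set: R] I.
  pose F (z : R * R * R) :=
    (rate s LoS `|z.1.1| (z.1.2, z.2) + rate s NLoS `|z.1.1| (z.1.2, z.2))%:E.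
  have F0 z b : [set: R] b -> (0 <= F (z, b))%E.
    by move=> _; rewrite lee_fin addr_ge0// exclusion_rate_ge0.
  have mshape : measurable_fun [set: (R * R * R)%type]
      (fun z : R * R * R => (z.1.1, (z.1.2, z.2))).
    have m1 : measurable_fun [set: (R * R * R)%type] (fun z : R * R * R => z.1).
      exact: measurable_fst.
    have m2 : measurable_fun [set: (R * R * R)%type] (fun z : R * R * R => z.2).
      exact: measurable_snd.
    apply: measurable_fun_pair; first exact: (measurableT_comp measurable_fst m1).
    apply: measurable_fun_pair => //.
    exact: (measurableT_comp measurable_snd m1).
  have mF : measurable_fun [set: (R * R * R)%type] F.
    apply/measurable_EFinP/measurable_funD.
      exact: (measurableT_comp (measurable_exclusion_rate2 s LoS) mshape).
    exact: (measurableT_comp (measurable_exclusion_rate2 s NLoS) mshape).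
  have mF2 := @measurable_fun_integral_in _ _ mplane (measurableTypeR R) R
    (@lebesgue_measure R) setT F measurableT mF F0.
  have F20 x y : [set: R] y ->
      (0 <= \int[@lebesgue_measure R]_b F ((x, y), b))%E.
    by move=> _; apply: integral_ge0 => b _; exact: F0.
  have mF3 := @measurable_fun_integral_in _ _ (measurableTypeR R)
    (measurableTypeR R) R (@lebesgue_measure R) setT _ measurableT mF2 F20.
  rewrite (_ : I = fun x => (\int[@lebesgue_measure R]_a
      \int[@lebesgue_measure R]_b F ((x, a), b))%E); first exact: mF3.
  apply/funext => x; rewrite /I fubini_tonelli1//.
    apply/measurable_EFinP; apply: measurable_funD;
      exact: measurable_exclusion_rate.
  by move=> y; rewrite lee_fin addr_ge0// exclusion_rate_ge0.
apply: (@eq_measurable_fun _ _ _ _ _ (fun x => p1 beta s x *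
    fine (expeR (- (lambda%:E * I x))%E))).
  move=> x; rewrite inE/= in_itv/= andbT => x0.
  rewrite (serving_densityE ell lambda0 mu0 mean0 BM s x0) /I ger0_norm//.
apply: measurable_funTS; apply: measurable_funM; first exact: measurable_p1.
apply: (measurableT_comp (f := fine)) => //.
apply: (measurableT_comp (@measurable_expeR R)).
apply: (measurableT_comp (@oppe_measurable R setT)).
by apply: emeasurable_funM.
Qed.

End density_measurability.

(** * Exponential decay of the serving density *)

Lemma sin_le (R : realType) (x y : R) : - (pi / 2) <= x -> x <= y ->
  y <= pi / 2 -> sin x <= sin y.
Proof.
move=> x1 + y1; rewrite le_eqVlt => /predU1P[->//|xy].
by rewrite ltW// ltr_sin ?in_itv/= ?x1 ?y1 ?(le_trans (ltW xy)) ?(le_trans x1)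
  ?(ltW xy).
Qed.

(* A fixed box of centres, lengths bounded below and nearly transverse
   orientations give segments crossing every long link in a cone. *)
Lemma crossing (R : realType) (l0 : R) : 0 < l0 ->
  exists eps eta T : R, [/\ 0 < eps, 0 < eta, eta <= pi, 0 < T &
    forall (c : R * R) (l a t theta : R), 1 <= c.1 <= 2 -> 0 <= c.2 <= eps ->
      l0 <= l -> pi / 4 <= a <= pi / 2 -> 0 <= theta <= eta -> T <= t ->
      blockage c l a `&` link (polar t theta) !=set0].
Proof.
move=> l00; have pi0 := @pi_gt0 R.
(* Orientations are at least pi/4 and links have direction at most pi/8, so their angle is at least
   pi/8 and its sine at least [m]. *)
pose m : R := sin (pi / 8).
have m0 : 0 < m by apply: sin_gt0_pi; apply/andP; split; lra.
have m1 : m <= 1 by exact: sin_le1.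
pose del : R := Num.min 1 (l0 * m / 8).
have del0 : 0 < del by rewrite lt_min ltr01 divr_gt0 ?mulr_gt0.
have del1 : del <= 1 by rewrite ge_min lexx.
have dell : del <= l0 * m / 8 by rewrite ge_min lexx orbT.
have [/andP[as1 as2] sas] : - (pi / 2) <= asin del <= pi / 2 /\
    sin (asin del) = del by apply: asin_def; apply/andP; split; lra.
have as0 : 0 < asin del.
  rewrite -ltr_sin ?in_itv/= ?as1 ?as2//; first by rewrite sas sin0.
  by apply/andP; split; lra.
(* With c the centre, eps <= m puts the crossing on the positive side of the origin: c2 cos a <= m
   <= c1 sin a. T = 2 / m puts it before the end of the link: c1 sin a <= 2 <= t m. The bounds eps
   <= l0 m / 4 and sin theta <= l0 m / 8 keep it within half a length of the centre; the cap 1 in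
   [del] only makes the arcsine meaningful. *)
exists (Num.min m (l0 * m / 4)), (Num.min (pi / 8) (asin del)), (2 / m).
split.
- by rewrite lt_min m0 divr_gt0 ?mulr_gt0.
- by rewrite lt_min as0 andbT; lra.
- by rewrite ge_min; apply/orP; left; lra.
- by rewrite divr_gt0.
move=> [c1 c2] l a t th /= /andP[c11 c12] /andP[c20]; rewrite le_min.
move=> /andP[c2m c2l] l0l /andP[a1 a2] /andP[th0]; rewrite le_min.
move=> /andP[th1 th2] Tt; apply/hitsP; rewrite /hits/=.
have tm : 2 <= t * m by rewrite -ler_pdivrMr.
have t0 : 0 < t by rewrite (lt_le_trans _ Tt)// divr_gt0.
have sth : sin th <= del by rewrite -sas; apply: sin_le => //; lra.
have sth0 : 0 <= sin th by apply: sin_ge0_pi; apply/andP; split; lra.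
have cth0 : 0 <= cos th by apply: cos_ge0_pihalf; apply/andP; split; lra.
have cth1 : cos th <= 1 by exact: cos_le1.
have sa : m <= sin a by apply: sin_le; lra.
have sa1 : sin a <= 1 by exact: sin_le1.
have ca0 : 0 <= cos a by apply: cos_ge0_pihalf; apply/andP; split; lra.
have ca1 : cos a <= 1 by exact: cos_le1.
have DE : t * cos th * sin a - t * sin th * cos a = t * sin (a - th).
  by rewrite sinB; ring.
have sD : m <= sin (a - th) by apply: sin_le; lra.
rewrite DE; set S := sin (a - th) in sD *.
have tS : 0 < t * S by rewrite mulr_gt0// (lt_le_trans m0).
rewrite gt_eqF//= (gtr0_norm tS); apply/and3P; split.
- have -> : c1 * (t * sin th) - c2 * (t * cos th) =
    t * (c1 * sin th - c2 * cos th) by ring.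
  rewrite normrM gtr0_norm// mulrCA ler_pM2l//.
  have lS : l0 * m <= l * S by apply: ler_pM => //; exact: ltW.
  rewrite ler_norml; apply/andP; split; nra.
- by rewrite mulr_ge0// ?(ltW tS)//; nra.
- rewrite expr2 ler_pM2r//.
  have : 2 <= t * S by rewrite (le_trans tm)// ler_pM2l.
  nra.
Qed.

(** Otherwise all the sets l >= 1/(n+1) would be null, hence also their union l > 0, and the
    positive part of the length would integrate to 0. *)
Lemma mean_gt0_exists_length (R : realType)
    (law : probability (measurableTypeR R) R) : (0 < mean law)%E ->
  exists2 l0 : R, 0 < l0 & (0 < law [set l : R | (l0 <= l)%R])%E.
Proof.
move=> mean0; apply: contrapT => H.
have A0 (l0 : R) : 0 < l0 -> law [set l : R | (l0 <= l)%R] = 0%E.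
  move=> l00; apply/eqP; rewrite eq_le measure_ge0 andbT leNgt.
  by apply/negP => lt0; apply: H; exists l0.
pose A (n : nat) : set (measurableTypeR R) := [set l : R | n.+1%:R^-1 <= l].
have mA n : measurable (A n).
  rewrite (_ : A n = `[n.+1%:R^-1, +oo[%classic); first exact: measurable_itv.
  by apply/seteqP; split => x /=; rewrite in_itv/= andbT.
have UA : \bigcup_n A n = [set l : R | 0 < l].
  apply/seteqP; split => [l [n _]|l /= l0].
    by rewrite /A/=; apply: lt_le_trans; rewrite invr_gt0 ltr0n.
  exists (Num.truncn l^-1) => //; rewrite /A/= invf_ple ?posrE ?ltr0n//.
  by rewrite ltW// truncnS_gt.
have lawU : law (\bigcup_n A n) = 0%E.
  have : (law \o A) x @[x --> \oo] --> law (\bigcup_n A n).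
    apply: nondecreasing_cvg_mu => //; first exact: bigcupT_measurable.
    move=> m n mn; apply/subsetPset => l; rewrite /A/=; apply: le_trans.
    by rewrite lef_pV2 ?posrE ?ltr0n// ler_nat ltnS.
  rewrite (_ : law \o A = cst 0%E); last first.
    by apply/funext => n /=; rewrite A0// invr_gt0 ltr0n.
  by move=> /(cvg_unique _ (cvg_cst _)) => <-.
have : (mean law <= 0)%E.
  rewrite /mean integralE (@le_trans _ _ (\int[law]_x ((fun x : R => x%:E)^\+ x)))%E//.
    by rewrite -[leRHS]adde0 leeD// oppe_le0 integral_ge0.
  rewrite (_ : (\int[law]_x _ =
      \int[law]_(x in \bigcup_n A n) ((fun x : R => x%:E)^\+ x))%E).
    rewrite null_set_integral//; first exact: bigcupT_measurable.
    by apply: measurable_funTS; apply: measurable_funepos; exact/measurable_EFinP.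
  rewrite [RHS]integral_mkcond; apply: eq_integral => x _.
  rewrite patchE; case: ifPn => //; rewrite UA notin_setE/= => /negP.
  by rewrite -leNgt => x0; rewrite funeposE; apply/max_idPr; rewrite lee_fin.
by rewrite leNgt mean0.
Qed.

Lemma uniform_prob_itv_gt0 (R : realType) (a b c e : R) (ab : a < b) :
  a <= c -> c < e -> e <= b -> (0 < uniform_prob ab `[c, e])%E.
Proof.
move=> ac ce eb; rewrite /uniform_prob.
rewrite (eq_integral (fun=> (b - a)^-1%:E)); last first.
  move=> x; rewrite inE/= in_itv/= /uniform_pdf => /andP[cx xe].
  by rewrite (le_trans ac cx) (le_trans xe eb).
rewrite integral_cst//= lebesgue_measure_itv/= lte_fin ce -EFinD -EFinM lte_fin.
by rewrite mulr_gt0// ?invr_gt0 subr_gt0.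
Qed.

(** Some centre falls in the box [K] with probability at least 1 - exp (- mu eps). The first such
    centre has a random index, but the event that this index is i depends on the centres only; the
    marks of segment i are therefore independent of it, and they are favourable with the same
    probability [kappa] for every i. *)
Lemma blocking_prob_ge (R : realType) (mu : R)
    (law : probability (measurableTypeR R) R)
    (db : measure_display) (OmegaB : measurableType db)
    (PB : probability OmegaB R)
    (C : nat -> OmegaB -> R * R) (Len Ori : nat -> OmegaB -> R) :
  0 < mu -> (0 < mean law)%E -> boolean_model PB mu law C Len Ori ->
  exists delta eta T : R, [/\ 0 < delta, 0 < eta, eta <= pi, 0 < T &
    forall t theta : R, T <= t -> 0 <= theta <= eta ->
      delta <= fine (PB (link_is C Len Ori NLoS (polar t theta)))].
Proof.
move=> mu0 mean0 BM.
have [l0 l00 lawl0] := mean_gt0_exists_length mean0.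
have [eps [eta [T [eps0 eta0 etapi T0 cross]]]] := crossing l00.
have pi0 := @pi_gt0 R.
pose B : set R := [set l | l0 <= l].
pose O : set R := `[pi / 4, pi / 2]%classic.
have mB : measurable B.
  rewrite (_ : B = `[l0, +oo[%classic); first exact: measurable_itv.
  by apply/seteqP; split => x /=; rewrite in_itv/= andbT.
have mO : measurable O by exact: measurable_itv.
pose K : set (R * R) := `[1, 2]%classic `*` `[0, eps]%classic.
have mK : measurable K by exact: measurableX.
have areaK : area K = eps%:E.
  rewrite /area /K product_measure1E//= !lebesgue_measure_itv/= !lte_fin.
  rewrite eps0 ltr1n/= -!EFinB -EFinM; congr EFin; ring.
pose A i := C i @^-1` K.
have mA i : measurable (A i).
  rewrite -[A i]setTI; exact: (PPP_measurable (boolean_centres BM) i).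
pose F := seqDU A.
have mF i : measurable (F i).
  by apply: measurableD => //; exact: bigsetU_measurable.
have sF i : sigma_points C (F i).
  have sA j : @measurable _ (g_sigma_algebraType [set E |
      exists i (B : set (R * R)), measurable B /\ E = C i @^-1` B]) (A j).
    by apply: sub_sigma_algebra; exists j, K.
  apply: (@measurableD _ (g_sigma_algebraType [set E |
      exists i (B : set (R * R)), measurable B /\ E = C i @^-1` B])) => //.
  exact: bigsetU_measurable.
pose kappa := (law B * uniform_prob (pi_gt0 R) O)%E.
have kappa0 : (0 < kappa)%E.
  by rewrite mule_gt0// /O; apply: uniform_prob_itv_gt0; lra.
have kfin : kappa \is a fin_num.
  by rewrite fin_numM// fin_num_measure.
pose E i := F i `&` [set w | B (Len i w) /\ O (Ori i w)].
have mE i : measurable (E i).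
  apply: measurableI => //; apply: (@measurableI _ _ (Len i @^-1` B)
    (Ori i @^-1` O)).
    rewrite -[X in measurable X]setTI; exact: (boolean_Len_measurable BM i).
  rewrite -[X in measurable X]setTI; exact: (boolean_Ori_measurable BM i).
have PE i : (PB (E i) = kappa * PB (F i))%E.
  (* The marks are prescribed for an initial range of indices, so those before i are left
     unconstrained. *)
  pose Bs (j : 'I_i.+1) : set R := if j == ord_max then B else setT.
  pose Os (j : 'I_i.+1) : set R := if j == ord_max then O else setT.
  have := @boolean_marks _ _ _ _ _ _ _ _ _ BM (F i) i.+1 Bs Os (sF i).
  rewrite big_ord_recr/= big1; last first.
    move=> j _; rewrite /Bs /Os -val_eqE/= ltn_eqF//.
    by rewrite !probability_setT mule1.
  rewrite /Bs /Os eqxx mul1e muleC -/kappa => <-.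
  - congr (PB _); apply/seteqP; split => w [Fw] /= H; split => //.
      by move=> j; case: eqP => // ->.
    by have := H ord_max; rewrite eqxx.
  - by move=> j; case: ifP.
  - by move=> j; case: ifP.
have PU : (PB (\bigcup_i E i) = kappa * PB (\bigcup_i A i))%E.
  rewrite (seqDU_bigcup_eq A) !measure_bigcup//; last first.
    by apply: trivIset_setIr; exact: trivIset_seqDU.
  rewrite -(fineK kfin) -nneseriesZl//; apply: eq_eseriesr => i _.
  by rewrite fineK//; exact: PE.
have mUA : measurable (\bigcup_i A i) by exact: bigcupT_measurable.
have PA : ((1 - expR (- (mu * eps)))%:E <= PB (\bigcup_i A i))%E.
  rewrite -[X in PB X]setCK probability_setC; last exact: measurableC.
  rewrite EFinB leeB//.
  have areaKfin (j : 'I_1) : (area K < +oo)%E by rewrite areaK ltry.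
  have tK : trivIset [set: 'I_1] (fun=> K).
    by move=> i j _ _ _; rewrite (ord1 i) (ord1 j).
  have := PPP_counts (boolean_centres BM) (fun=> 0%N) (fun=> mK) areaKfin tK.
  rewrite big_ord1 /poisson_weight expr0 fact0 divr1 mulr1 areaK/= => <-.
  apply: le_measure; rewrite ?inE.
  - exact: measurableC.
  - rewrite (_ : [set w | _] = [set w | npoints C K w = 0%:R%:E]).
      exact: (measurable_npoints_eq (boolean_centres BM)).
    by apply/seteqP; split => w /= H; [exact: H ord0|].
  - move=> w wU j; rewrite /npoints eseries0// => i _ _.
    rewrite indicE memNset// => Kw; apply: wU; by exists i.
exists (fine kappa * (1 - expR (- (mu * eps)))), eta, T; split => //.
  rewrite mulr_gt0 ?fine_gt0 ?kappa0 ?ltey_eq ?kfin//.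
  by rewrite subr_gt0 expR_lt1 oppr_lt0 mulr_gt0.
move=> t th Tt th01.
rewrite -lee_fin fineK ?fin_num_measure//; last exact: measurable_link_is1 BM _ _.
rewrite EFinM fineK// (@le_trans _ _ (PB (\bigcup_i E i)))//.
  by rewrite PU lee_pmul2l.
apply: le_measure; rewrite ?inE.
- exact: bigcupT_measurable.
- exact: measurable_link_is1 BM _ _.
move=> w [i _ [Fw [/= Bw]]]; rewrite /O/= in_itv/= => Ow clear.
have [+ _] := Fw; rewrite /A/= /K => -[/=]; rewrite !in_itv/= => c1 c2.
have /set0P := cross _ _ _ _ _ c1 c2 Bw Ow th01 Tt.
by rewrite (clear i) eqxx.
Qed.

(** Half of the exponential absorbs the factor x, by x <= (2/c) exp (c x / 2); the other half is an
    exponential density up to a constant. The second factor 2/c in [K] undoes the normalisation of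
    that density. *)
Lemma exp_decay_moment (R : realType) (a c : R) (f : R -> R) : 0 < c ->
  measurable_fun (`[0, +oo[ : set R) f ->
  (forall x, 0 <= x -> 0 <= f x <= expR (a - c * x)) ->
  (\int[@lebesgue_measure R]_(x in `[0%R, +oo[) (f x * x)%:E < +oo)%E.
Proof.
move=> c0 mf fle; have c2 : 0 < c / 2 by rewrite divr_gt0.
pose K : R := expR a * (2 / c) ^+ 2.
have K0 : 0 <= K by rewrite mulr_ge0 ?expR_ge0 ?sqr_ge0.
have mpdf : measurable_fun [set: R] (EFin \o exponential_pdf (c / 2)).
  by apply/measurable_EFinP; exact: measurable_exponential_pdf.
apply: (@le_lt_trans _ _ K%:E); last by rewrite ltry.
apply: (@le_trans _ _ (\int[@lebesgue_measure R]_(x in `[0%R, +oo[)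
    (K%:E * (exponential_pdf (c / 2) x)%:E))%E).
  apply: ge0_le_integral => //.
  - move=> x /=; rewrite in_itv/= andbT => x0; rewrite lee_fin mulr_ge0//.
    by case/andP: (fle x x0).
  - by apply/measurable_EFinP; exact: measurable_funM.
  - by apply: measurable_funTS; exact: emeasurable_funM.
  - move=> x /=; rewrite in_itv/= andbT => x0; rewrite -EFinM lee_fin.
    have /andP[fx0 fx1] := fle x x0.
    apply: (le_trans (ler_wpM2r x0 fx1)).
    rewrite exponential_pdfE//.
    have -> : expR (a - c * x) =
        expR a * expR (- (c / 2) * x) * expR (- (c / 2) * x).
      by rewrite -!expRD; congr expR; field.
    have -> : K * (c / 2 * expR (- (c / 2) * x)) =
        expR a * expR (- (c / 2) * x) * (2 / c).
      by rewrite /K; field; rewrite gt_eqF.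
    rewrite -[leLHS]mulrA ler_pM2l ?mulr_gt0 ?expR_gt0//.
    have -> : expR (- (c / 2) * x) * x = x / expR (c / 2 * x).
      by rewrite mulNr expRN mulrC.
    rewrite ler_pdivrMr ?expR_gt0//.
    have h := expR_ge1Dx (c / 2 * x).
    have -> : x = 2 / c * (c / 2 * x) by field; rewrite gt_eqF.
    rewrite ler_pM2l ?divr_gt0//.
    have -> : c / 2 * (2 / c * (c / 2 * x)) = c / 2 * x by field; rewrite gt_eqF.
    by apply: le_trans h; rewrite lerDr.
rewrite ge0_integralZl//; last 2 first.
- exact: measurable_funS mpdf.
- by move=> x _; rewrite lee_fin exponential_pdf_ge0// ltW.
rewrite -[leRHS]mule1 lee_wpmul2l ?lee_fin//.
rewrite -(integral_exponential_pdf c2); apply: ge0_subset_integral => //.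
by move=> x _; rewrite lee_fin exponential_pdf_ge0// ltW.
Qed.

(** Only the sector T <= t <= x, 0 <= theta <= eta is kept, with its Jacobian t bounded below by T.
    The resulting bound is linear in x, which is enough for exponential decay. *)
Lemma plane_integral_ge (R : realType) (f : R * R -> R) (k eta T x : R) :
  measurable_fun [set: (R * R)%type] f -> (forall y, 0 <= f y) ->
  0 <= k -> 0 <= eta -> eta <= 2 * pi -> 0 < T -> T <= x ->
  (forall t theta, T <= t <= x -> 0 <= theta <= eta ->
    k <= f (polar t theta)) ->
  ((k * T * (x - T) * eta)%:E <=
   \int[@lebesgue_measure R \x @lebesgue_measure R]_y (f y)%:E)%E.
Proof.
move=> mf f0 k0 eta0 etapi T0 Tx kf.
pose H a := (\int[@lebesgue_measure R]_(t in `]0%R, +oo[)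
  ((f (polar t a))%:E * t%:E))%E.
have mft : measurable_fun [set: (R * R)%type]
    (fun z : R * R => (f (polar z.2 z.1))%:E * (z.2)%:E)%E.
  have msw : measurable_fun [set: (R * R)%type] (fun z : R * R => (z.2, z.1)).
    by apply: measurable_fun_pair; [exact: measurable_snd|exact: measurable_fst].
  apply: emeasurable_funM; apply/measurable_EFinP; last exact: measurable_snd.
  exact: (measurableT_comp mf (measurableT_comp (@measurable_polar R) msw)).
have ft0 a t : `]0, +oo[%classic t -> (0 <= (f (polar t a))%:E * t%:E)%E.
  rewrite /= in_itv/= andbT => t0; apply: mule_ge0; rewrite lee_fin ?f0//.
  exact: ltW.
have mH : measurable_fun [set: R] H.
  exact: (@measurable_fun_integral_in _ _ (measurableTypeR R) (measurableTypeR R)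
    R (@lebesgue_measure R) _ _ (measurable_itv _) mft ft0).
have H0 a : (0 <= H a)%E by apply: integral_ge0 => t; exact: ft0.
rewrite ge0_integral_polar//; last exact/measurable_EFinP.
apply: (@le_trans _ _ (\int[@lebesgue_measure R]_(a in `[0%R, eta]) H a)%E);
  last first.
  apply: ge0_subset_integral => //; first exact: measurable_funS mH.
  by apply: subset_itvl; rewrite bnd_simp.
apply: (@le_trans _ _ (\int[@lebesgue_measure R]_(a in `[0%R, eta])
    (k * T * (x - T))%:E)%E).
  rewrite integral_cst//= lebesgue_measure_itv/= lte_fin.
  case: ltP => [_|eta0']; first by rewrite oppr0 adde0 EFinM.
  by rewrite (_ : eta = 0) ?mulr0 ?mule0//; apply/eqP; rewrite eq_le eta0'.
have Tx0 : 0 <= x - T by rewrite subr_ge0.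
apply: ge0_le_integral => //.
- by move=> a _; rewrite lee_fin !mulr_ge0// ltW.
- exact: measurable_funS mH.
move=> a /=; rewrite in_itv/= => a0.
have mfa : measurable_fun [set: R] (fun t => (f (polar t a))%:E * t%:E)%E.
  exact: (measurable_fun_pair2 a mft).
apply: (@le_trans _ _ (\int[@lebesgue_measure R]_(t in `[T, x])
    ((f (polar t a))%:E * t%:E))%E); last first.
  apply: ge0_subset_integral => //.
  - exact: measurable_funS mfa.
  - by move=> t; exact: ft0.
  - by move=> t /=; rewrite !in_itv/= andbT => /andP[/(lt_le_trans T0)].
apply: (@le_trans _ _ (\int[@lebesgue_measure R]_(t in `[T, x])
    (k * T)%:E)%E).
  rewrite integral_cst//= lebesgue_measure_itv/= lte_fin.
  case: ltP => [_|Tx']; first by rewrite -EFinB -EFinM.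
  by rewrite (_ : x = T) ?subrr ?mulr0 ?mule0//; apply/eqP; rewrite eq_le Tx'.
apply: ge0_le_integral => //.
- by move=> t _; rewrite lee_fin mulr_ge0// ltW.
- exact: measurable_funS mfa.
move=> t /=; rewrite in_itv/= => /andP[Tt tx]; rewrite -EFinM lee_fin.
by rewrite ler_pM ?(ltW T0)// kf// Tt.
Qed.

Section density_decay.
Context (R : realType) (lambda mu : R)
  (law : probability (measurableTypeR R) R)
  (db : measure_display) (OmegaB : measurableType db)
  (PB : probability OmegaB R)
  (C : nat -> OmegaB -> R * R) (Len Ori : nat -> OmegaB -> R)
  (ell : link_type -> R -> R)
  (lambda0 : 0 < lambda) (mu0 : 0 < mu) (mean0 : (0 < mean law < +oo)%E)
  (BM : boolean_model PB mu law C Len Ori).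

Local Notation plane := (@lebesgue_measure R \x @lebesgue_measure R)%E.
Local Notation beta := (blockage_rate mu law).
Local Notation p_joint := (p_joint PB C Len Ori).
Local Notation rate := (exclusion_rate mu law PB C Len Ori ell).
Local Notation density :=
  (serving_density lambda ell (p1 beta) (p2 PB C Len Ori)).

Lemma serving_density_le (s : link_type) (x r : R) : 0 <= x -> 0 <= r ->
  (r%:E <= \int[plane]_y (rate s LoS x y + rate s NLoS x y)%:E)%E ->
  0 <= density s x <= p1 beta s x * expR (- (lambda * r)).
Proof.
move=> x0 r0; rewrite (serving_densityE ell lambda0 mu0 mean0 BM s x0).
set I := (\int[plane]_y _)%E => rI.
have p0 := p1_ge0 mu0 mean0 s x0.
have le : (expeR (- (lambda%:E * I)) <= (expR (- (lambda * r)))%:E)%E.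
  rewrite -[(expR _)%:E]/(expeR (- (lambda%:E * r%:E))%E) lee_expeR leeN2.
  by rewrite lee_wpmul2l// lee_fin ltW.
have e0 := expeR_ge0 (- (lambda%:E * I))%E.
have efin : expeR (- (lambda%:E * I))%E \is a fin_num.
  by rewrite ge0_fin_numE// (le_lt_trans le)// ltry.
rewrite mulr_ge0 ?fine_ge0//= ler_wpM2l//.
by rewrite -lee_fin fineK.
Qed.

(** For LoS the factor exp (- beta x) is the bound. For NLoS, beyond [x1] the rate is at least del/2
    on a sector, so the exponent is at most - c (x - T). The hypothesis on single links comes from
    the first-order law rather than from the Boolean model. *)
Lemma density_decay (s : link_type) :
  (forall x : R, 0 < x ->
    fine (PB (link_is C Len Ori LoS (polar x 0))) = p1 beta LoS x) ->
  exists a c : R, 0 < c /\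
    (forall x, 0 <= x -> 0 <= density s x <= expR (a - c * x)).
Proof.
move=> linkL; have b0 : 0 < beta := blockage_rate_gt0 mu0 mean0.
have I0 s' x : 0 <= x ->
    (0%:E <= \int[plane]_y (rate s' LoS x y + rate s' NLoS x y)%:E)%E.
  by move=> x0; apply: integral_ge0 => y _; rewrite lee_fin addr_ge0//;
    exact: exclusion_rate_ge0.
case: s.
  exists 0, beta; split => // x x0.
  have := serving_density_le x0 (lexx 0) (I0 LoS x x0).
  by rewrite mulr0 oppr0 expR0 mulr1 sub0r.
have mean00 : (0 < mean law)%E by case/andP: mean0.
have [del [eta [T [del0 eta0 etapi T0 block]]]] := blocking_prob_ge mu0 mean00 BM.
have pi0 := @pi_gt0 R.
pose c : R := lambda * (del / 2 * T * eta).
have c0 : 0 < c by rewrite !mulr_gt0.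
(* Beyond [x1], exp (- beta x) <= del / 2, so half of the blocking probability survives. Below [x1]
   the bound exp (c (x1 - x)) is at least 1 and holds trivially. *)
pose x1 : R := Num.max T (- ln (del / 2) / beta).
have x1T : T <= x1 by rewrite le_max lexx.
exists (c * x1), c; split => // x x0.
have p1le : p1 beta NLoS x <= 1 by rewrite /= gerBl expR_ge0.
have p10 := p1_ge0 mu0 mean0 NLoS x0.
have [xx1|xx1] := ltP x x1.
  have := serving_density_le x0 (lexx 0) (I0 NLoS x x0).
  rewrite mulr0 oppr0 expR0 mulr1 => /andP[-> dp] /=.
  rewrite (le_trans dp)// (le_trans p1le)// -expR0 ler_expR -mulrBr.
  by rewrite mulr_ge0 ?subr_ge0 ?(ltW xx1)// ltW.
have Tx : T <= x by exact: le_trans x1T xx1.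
have xpos : 0 < x by exact: lt_le_trans T0 Tx.
have p1pos : 0 < p1 beta NLoS x by exact: p1_gt0.
have ex : expR (- (beta * x)) <= del / 2.
  rewrite -[leRHS]lnK ?posrE ?divr_gt0// ler_expR lerNl.
  rewrite [leRHS]mulrC -ler_pdivrMr//; apply: le_trans xx1.
  by rewrite /x1 le_max lexx orbT.
have rate_ge (t theta : R) : T <= t <= x -> 0 <= theta <= eta ->
    del / 2 <= rate NLoS NLoS x (polar t theta).
  move=> /andP[Tt tx] th.
  have t0 : 0 < t by exact: lt_le_trans T0 Tt.
  rewrite /exclusion_rate indicE mem_set ?mulr1; last first.
    rewrite /= /enorm/= !exprMn -mulrDr cos2Dsin2 mulr1 sqrtr_sqr.
    by rewrite gtr0_norm// lee_fin.
  rewrite ler_pdivlMr// (@le_trans _ _ (del / 2))//.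
    by rewrite ler_piMr// ltW// divr_gt0.
  have mL (s : link_type) y : measurable (link_is C Len Ori s y).
    exact: measurable_link_is1 BM _ _.
  have h1 := block t theta Tt th.
  have h2 := linkL x xpos.
  (* When the link to (t, theta) is blocked, either both links are blocked or the link of length x
     is LoS. This avoids any study of the correlation between the two links. *)
  suff : fine (PB (link_is C Len Ori NLoS (polar t theta))) <=
      p_joint NLoS NLoS (polar x 0) (polar t theta) +
      fine (PB (link_is C Len Ori LoS (polar x 0))).
    by rewrite h2 /=; lra.
  rewrite /Defs.p_joint -fineD ?fin_num_measure//; last exact: measurableI.
  apply: fine_le; rewrite ?fin_num_measure//.
    by rewrite fin_numD !fin_num_measure//; exact: measurableI.
  apply: le_trans (measureU2 _ _ _) => //; last exact: measurableI.
  apply: le_measure; rewrite ?inE//.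
    by apply: measurableU => //; exact: measurableI.
  move=> w /= wN; have [wL|wL] := pselect (link_is C Len Ori LoS (polar x 0) w).
    by right.
  by left.
have xT0 : 0 <= x - T by rewrite subr_ge0.
have r0 : 0 <= del / 2 * T * (x - T) * eta.
  by rewrite !mulr_ge0// ltW.
have lowI : ((del / 2 * T * (x - T) * eta)%:E <=
    \int[plane]_y (rate NLoS LoS x y + rate NLoS NLoS x y)%:E)%E.
  apply: plane_integral_ge => //.
  - by apply: measurable_funD; exact: measurable_exclusion_rate.
  - by move=> y; rewrite addr_ge0// exclusion_rate_ge0.
  - by rewrite ltW// divr_gt0.
  - exact: ltW.
  - by apply: le_trans etapi _; lra.
  - move=> t theta tT th; apply: le_trans (rate_ge t theta tT th) _.
    by rewrite lerDr exclusion_rate_ge0.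
have /andP[-> dle] /= := serving_density_le x0 r0 lowI.
apply: (le_trans dle); rewrite -[leRHS]mul1r.
apply: ler_pM => //.
rewrite ler_expR.
have -> : lambda * (del / 2 * T * (x - T) * eta) = c * (x - T).
  by rewrite /c; ring.
by rewrite -mulrBr -mulrN ler_pM2l// opprB lerB.
Qed.

End density_decay.

(** Once the serving probability is identified with g_s, both claims are a rescaling of one
    integral. The normalisation needs A_s finite, since [fine] sends an infinite value to 0. *)
Theorem lemma6 (R : realType) (lambda mu : R)
    (law : probability (measurableTypeR R) R) (* law of the blockage length *)
    (db : measure_display) (OmegaB : measurableType db)
    (PB : probability OmegaB R)
    (C : nat -> OmegaB -> R * R) (Len Ori : nat -> OmegaB -> R)
    (ell : link_type -> R -> R)
    (d : measure_display) (Omega : measurableType d)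
    (Q : R -> probability Omega R) (T0 : Omega -> link_type)
    (X : nat -> Omega -> R * R) (M : nat -> Omega -> link_type) :
  0 < lambda -> 0 < mu ->
  law [set l : R | 0 <= l] = 1%E -> (0 < mean law < +oo)%E ->
  boolean_model PB mu law C Len Ori ->
  path_loss ell ->
  let beta := blockage_rate mu law in
  (forall r : R, 0 < r ->
    first_order_law PB C Len Ori beta (Q r) lambda r T0 X M) ->
  let p := p1 beta in
  let pp := p2 PB C Len Ori in
  let G := G lambda ell Q T0 X M in
  let A s := G s 0 in
  let g s := match s with
    | LoS => gL lambda ell p pp
    | NLoS => gN lambda ell p pp
    end in
  forall s : link_type,
    A s = ((2 * pi * lambda)%:E *
            \int[@lebesgue_measure R]_(x in `[0%R, +oo[) (g s x * x)%:E)%E /\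
    ((0 < A s)%E ->
      is_pdf (fun x => (fine (A s))^-1 * (2 * pi * lambda) * g s x * x)
             (fun r => fine (G s r) / fine (A s))).

Proof.
move=> lambda0 mu0 _ mean0 BM PL beta FO p pp G0 A g s.
have b0 : 0 < beta := blockage_rate_gt0 mu0 mean0.
have gE x : g s x = serving_density lambda ell (p1 beta) (p2 PB C Len Ori) s x.
  by case: s.
have linkL x : 0 < x ->
    fine (PB (link_is C Len Ori LoS (polar x 0))) = p1 beta LoS x.
  by move=> x0; exact: (link_is_prob mu0 mean0 BM x0 (FO x x0)).
have [a [c [c0 gle]]] := density_decay ell lambda0 mu0 mean0 BM s linkL.
have mg : measurable_fun (`[0, +oo[ : set R) (g s).
  have := measurable_density lambda0 mu0 mean0 BM PL s.
  by apply: eq_measurable_fun => x _; rewrite gE.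
have gfin : (\int[@lebesgue_measure R]_(x in `[0%R, +oo[)
    (g s x * x)%:E < +oo)%E.
  by apply: (exp_decay_moment c0 mg) => x x0; rewrite gE; exact: gle.
have g0 x : 0 <= x -> 0 <= g s x.
  by move=> x0; rewrite gE; case/andP: (gle x x0).
have gx0 r x : 0 <= r -> `]r, +oo[%classic x -> (0 <= (g s x * x)%:E)%E.
  move=> r0; rewrite /= in_itv/= andbT => /(le_lt_trans r0) x0.
  by rewrite lee_fin mulr_ge0 ?g0// ltW.
have mgx : measurable_fun (`[0, +oo[ : set R) (fun x => (g s x * x)%:E).
  by apply/measurable_EFinP; exact: measurable_funM.
have subr r : 0 <= r -> `]r, +oo[%classic `<=` (`[0, +oo[%classic : set R).
  by move=> r0 x /=; rewrite !in_itv/= !andbT => /ltW; exact: le_trans.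
have mgr r : 0 <= r -> measurable_fun (`]r, +oo[ : set R)
    (fun x => (g s x * x)%:E).
  by move=> r0; apply: measurable_funS mgx => //; exact: subr.
pose k : R := 2 * pi * lambda.
have k0 : 0 < k by rewrite !mulr_gt0 ?pi_gt0.
(* The integral runs over x > r >= 0, so Q_x is used only at x > 0, where the first-order law is
   available. *)
have GE r : 0 <= r -> (G0 s r = k%:E *
    \int[@lebesgue_measure R]_(x in `]r, +oo[) (g s x * x)%:E)%E.
  move=> r0; rewrite /G0 /G; congr (_ * _)%E; apply: eq_integral => x.
  rewrite inE/= in_itv/= andbT => /(le_lt_trans r0) x0.
  rewrite (serving_prob ell lambda0 mu0 mean0 BM x0 (FO x x0)) gE.
  by rewrite EFinM.
(* The tail integral at r = 0 leaves out the point 0, which is negligible. *)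
have AE : (A s = k%:E *
    \int[@lebesgue_measure R]_(x in `[0%R, +oo[) (g s x * x)%:E)%E.
  by rewrite /A GE// integral_itv_obnd_cbnd//; exact: mgr.
split; first exact: AE.
move=> A0.
have int0 r : 0 <= r ->
    (0 <= \int[@lebesgue_measure R]_(x in `]r, +oo[) (g s x * x)%:E)%E.
  by move=> r0; apply: integral_ge0 => x; exact: gx0.
have gx00 x : `[0, +oo[%classic x -> (0 <= (g s x * x)%:E)%E.
  by rewrite /= in_itv/= andbT => x0; rewrite lee_fin mulr_ge0 ?g0.
have Afin : A s \is a fin_num.
  by rewrite ge0_fin_numE ?(ltW A0)// AE lte_mul_pinfty// ?lee_fin ?(ltW k0).
have fA0 : 0 < fine (A s) by rewrite fine_gt0// A0 ltey_eq Afin.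
have Gfin r : 0 <= r -> G0 s r \is a fin_num.
  move=> r0; rewrite GE// fin_numM// ge0_fin_numE ?int0//.
  apply: le_lt_trans gfin; apply: ge0_subset_integral => //.
  exact: subr.
have scale (D : set R) : measurable D ->
    measurable_fun D (fun x => (g s x * x)%:E) ->
    (forall x, D x -> (0 <= (g s x * x)%:E)%E) ->
    (\int[@lebesgue_measure R]_(x in D)
      ((fine (A s))^-1 * (2 * pi * lambda) * g s x * x)%:E =
     ((fine (A s))^-1)%:E * (k%:E *
       \int[@lebesgue_measure R]_(x in D) (g s x * x)%:E))%E.
  move=> mD mgD gD; rewrite muleA -EFinM -ge0_integralZl//; last first.
    by rewrite lee_fin mulr_ge0 ?invr_ge0 ?(ltW fA0)// ltW.
  by apply: eq_integral => x _; rewrite -EFinM !mulrA.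
split.
- by apply: measurable_funM => //; exact: measurable_funM.
- move=> x x0; rewrite !mulr_ge0 ?invr_ge0 ?pi_ge0 ?g0//; exact: ltW.
- by rewrite scale// -AE -[X in (_ * X)%E](fineK Afin) -EFinM mulVf// gt_eqF.
- move=> r r0; rewrite scale//; [|exact: mgr|by move=> x; exact: gx0].
  by rewrite -GE// EFinM fineK ?Gfin// muleC.
Qed.
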